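(* Let $T:\mathbb{C}[x_1,\dots,x_d]\to\mathbb{C}$ be a pseudo-positive definite functional (with respect to the fixed orthonormal basis $Y_{k,l}$). Let $\sigma_{k,l}$, $k\in\mathbb{N}_0$, $l=1,\dots,a_k$, be non-negative measures with supports in $[0,\infty)$ representing $T$ in the sense that $T_{k,l}(p)=\int_0^\infty p(r^2)\,d\sigma_{k,l}(r)$ for all $p\in\mathbb{C}[t]$ and all $k,l$; equivalently $$T(f)=\sum_{k=0}^{\deg f}\sum_{l=1}^{a_k}\int_0^\infty f_{k,l}(r)\,r^{-k}\,d\sigma_{k,l}(r)\qquad\text{for all } f\in\mathbb{C}[x_1,\dots,x_d].$$ If for every $N\in\mathbb{N}_0$ $$\sum_{k=0}^{\infty}\sum_{l=1}^{a_k}\int_0^\infty r^{N}r^{-k}\,d\sigma_{k,l}(r)<\infty ,$$ then there exists a pseudo-positive, signed moment measure $\sigma$ on $\mathbb{R}^d$ such that $$T(f)=\int_{\mathbb{R}^d} f\,d\sigma\qquad\text{for all } f\in\mathbb{C}[x_1,\dots,x_d].$$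
   Context: Fix $d\ge 1$. $\mathbb{S}^{d-1}$ is the unit sphere of $\mathbb{R}^d$ with surface measure $d\theta$. $\mathcal{H}_k(\mathbb{R}^d)$ is the space of harmonic homogeneous complex polynomials of degree $k$ on $\mathbb{R}^d$, $a_k=\dim\mathcal{H}_k(\mathbb{R}^d)$, and $Y_{k,l}:\mathbb{R}^d\to\mathbb{R}$, $l=1,\dots,a_k$, is a fixed basis of $\mathcal{H}_k(\mathbb{R}^d)$, orthonormal for $\langle f,g\rangle=\int_{\mathbb{S}^{d-1}}f\overline{g}\,d\theta$. The Laplace–Fourier coefficients of a continuous function $f$ are $f_{k,l}(r)=\int_{\mathbb{S}^{d-1}}f(r\theta)Y_{k,l}(\theta)\,d\theta$. If $f$ is a polynomial, then $f_{k,l}(r)=r^kp_{k,l}(r^2)$ with univariate polynomials $p_{k,l}$, and $f(x)=\sum_{k=0}^{\deg f}\sum_{l=1}^{a_k}p_{k,l}(|x|^2)Y_{k,l}(x)$; the expression $f_{k,l}(r)r^{-k}$ then means $p_{k,l}(r^2)$, also at $r=0$. In the summability condition $r^Nr^{-k}=r^{N-k}$, with $0^0=1$ and $0^{-j}=+\infty$ for $j>0$. For a linear functional $T:\mathbb{C}[x_1,\dots,x_d]\to\mathbb{C}$ put $T_{k,l}(p):=T\big(p(|x|^2)Y_{k,l}(x)\big)$ for $p\in\mathbb{C}[t]$. $T$ is pseudo-positive definite if $T_{k,l}(p^*p)\ge0$ and $T_{k,l}(t\,p^*(t)p(t))\ge0$ for all $p\in\mathbb{C}[t]$ and all $k,l$,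 where $p^*$ has the complex conjugate coefficients of $p$. A signed measure is a real-valued $\sigma$-additive set function on the Borel sets; it is a (signed) moment measure if all polynomials are integrable with respect to its total variation. A signed measure $\mu$ on $\mathbb{R}^d$ is pseudo-positive if $\int_{\mathbb{R}^d}h(|x|)Y_{k,l}(x)\,d\mu(x)\ge0$ for every continuous compactly supported $h:[0,\infty)\to[0,\infty)$ and all $k\in\mathbb{N}_0$, $l=1,\dots,a_k$. *)

(* Defs.v *)
(* MathComp-Analysis, with R[i] for the complex numbers and multinomials for
   polynomials in several variables. *)
From HB Require Import structures.
From mathcomp Require Import all_boot all_order all_algebra complex.
From mathcomp.multinomials Require mpoly.
(* The notations of mpoly clash with those of MathComp-Analysis; imported
   before it, so that measure, Measure, etc. are those of measure theory. *)
Import -(notations) mpoly.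
From mathcomp Require Import all_classical all_reals all_analysis.
From mathcomp Require Import measurable_realfun.

Set Implicit Arguments.
Unset Strict Implicit.
Unset Printing Implicit Defensive.

Import Order.TTheory GRing.Theory Num.Theory.
Import numFieldNormedType.Exports.

Local Open Scope classical_set_scope.
Local Open Scope ring_scope.

(* The library's product sigma-algebra on tuples over the Borel line: this is
   the Borel sigma-algebra of R^d, since R is second countable. *)
Notation Rvec R d := (d.-tuple (measurableTypeR R)).

Section lebesgue_tuple.
Context {R : realType}.

Definition tcons n (xt : measurableTypeR R * Rvec R n) : Rvec R n.+1 :=
  [tuple of xt.1 :: xt.2].

Lemma measurable_tcons n : measurable_fun [set: _] (@tcons n).
Proof. exact: measurable_cons. Qed.

Lemma measurable_tuncons n :
  measurable_fun [set: Rvec R n.+1] (fun x => (thead x, [tuple of behead x])).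
Proof.
apply/measurable_fun_pairP; split.
  exact: measurable_tnth.
exact: measurable_behead.
Qed.

HB.instance Definition _ n :=
  @isMeasurableFun.Build _ _ _ _ (@tcons n) (@measurable_tcons n).

Section lebesgue_cons.
Variables (n : nat) (m : {sigma_finite_measure set (Rvec R n) -> \bar R}).

Definition lebesgue_cons : set (Rvec R n.+1) -> \bar R :=
  pushforward (lebesgue_measure \x m)%E (@tcons n).

Let lebesgue_cons0 : lebesgue_cons set0 = 0%E.
Proof. exact: measure0. Qed.

Let lebesgue_cons_ge0 A : (0 <= lebesgue_cons A)%E.
Proof. exact: measure_ge0. Qed.

Let lebesgue_cons_sigma_additive : semi_sigma_additive lebesgue_cons.
Proof. exact: measure_semi_sigma_additive. Qed.

HB.instance Definition _ := isMeasure.Build _ _ _ lebesgue_cons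
  lebesgue_cons0 lebesgue_cons_ge0 lebesgue_cons_sigma_additive.

Let lebesgue_cons_sigma_finite : sigma_finite [set: _] lebesgue_cons.
Proof.
have /sigma_finiteP[F [TF ndF Foo]] := sigma_finiteT (@lebesgue_measure R).
have /sigma_finiteP[G [TG ndG Goo]] := sigma_finiteT m.
pose u (x : Rvec R n.+1) : measurableTypeR R * Rvec R n :=
  (thead x, [tuple of behead x]).
have consK : cancel (@tcons n) u.
  by move=> [x t]; congr pair; apply/val_inj.
exists (fun i => u @^-1` (F i `*` G i)) => [|i].
  rewrite -preimage_bigcup (_ : \bigcup_i _ = setT) ?preimage_setT//.
  rewrite -subTset => -[x t] _.
  have [i _ Fx] : (\bigcup_i F i) x by rewrite -TF.
  have [j _ Gt] : (\bigcup_i G i) t by rewrite -TG.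
  exists (maxn i j) => //; split.
    by move: x Fx; exact/subsetPset/ndF/leq_maxl.
  by move: t Gt; exact/subsetPset/ndG/leq_maxr.
have [[mF Fi] [mG Gi]] := (Foo i, Goo i).
split.
  by rewrite -[_ @^-1` _]setTI; apply: measurable_tuncons => //;
    exact: measurableX.
rewrite /lebesgue_cons /pushforward -comp_preimage (_ : u \o _ = id).
  by rewrite preimage_id product_measure1E// lte_mul_pinfty// ge0_fin_numE.
exact/funext.
Qed.

HB.instance Definition _ := Measure_isSigmaFinite.Build _ _ _ lebesgue_cons
  lebesgue_cons_sigma_finite.

End lebesgue_cons.

Fixpoint lebesgue_tuple n : {sigma_finite_measure set (Rvec R n) -> \bar R} :=
  if n is n'.+1 then lebesgue_cons (lebesgue_tuple n') else \d_[tuple].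

End lebesgue_tuple.

Section sphere.
Context {R : realType} {d : nat}.
Implicit Types x : Rvec R d.

Definition enorm x : R := Num.sqrt (\sum_(i < d) (tnth x i : R) ^+ 2).

Definition unit_sphere : set (Rvec R d) := [set x | enorm x = 1].

Definition punctured_ball : set (Rvec R d) := [set x | 0 < enorm x <= 1].

Definition radial_proj x : Rvec R d :=
  [tuple (tnth x i : R) / enorm x | i < d].

Lemma measurable_enorm : measurable_fun [set: Rvec R d] enorm.
Proof.
apply: (@measurableT_comp _ _ _ _ _ _ (@Num.sqrt R)).
  by apply: continuous_measurable_fun; exact: sqrt_continuous.
apply: measurable_sum => i; apply: measurable_funX.
exact: measurable_tnth.
Qed.

Lemma measurable_punctured_ball : measurable punctured_ball.
Proof.
rewrite (_ : punctured_ball = enorm @^-1` `]0, 1]).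
  by rewrite -[_ @^-1` _]setTI; exact: measurable_enorm.
by apply/seteqP; split => x; rewrite /punctured_ball/= in_itv.
Qed.

Lemma measurable_radial_proj : measurable_fun [set: Rvec R d] radial_proj.
Proof.
apply/measurable_fun_tnthP => i.
rewrite (_ : _ \o _ = fun x => (tnth x i : R) / enorm x); last first.
  by apply/funext => x /=; rewrite tnth_mktuple.
apply: (@measurable_funM _ _ _ _ (fun x : Rvec R d => tnth x i : R)).
  exact: measurable_tnth.
rewrite (_ : (fun x => (enorm x)^-1) = fun x => enorm x `^ (-1)); last first.
  by apply/funext => x; rewrite powR_inv1// sqrtr_ge0.
apply: (@measurableT_comp _ _ _ _ _ _ (@powR R ^~ (-1))).
  exact: measurable_powR.
exact: measurable_enorm.
Qed.

HB.instance Definition _ :=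
  @isMeasurableFun.Build _ _ _ _ radial_proj measurable_radial_proj.

Definition cone_measure : set (Rvec R d) -> \bar R :=
  pushforward (mrestr (lebesgue_tuple d) measurable_punctured_ball) radial_proj.

Let cone_measure0 : cone_measure set0 = 0%E.
Proof. exact: measure0. Qed.

Let cone_measure_ge0 A : (0 <= cone_measure A)%E.
Proof. exact: measure_ge0. Qed.

Let cone_measure_sigma_additive : semi_sigma_additive cone_measure.
Proof. exact: measure_semi_sigma_additive. Qed.

HB.instance Definition _ := isMeasure.Build _ _ _ cone_measure
  cone_measure0 cone_measure_ge0 cone_measure_sigma_additive.

(* A |-> d * |{r theta : 0 < r <= 1, theta in A}|, the surface measure of the
   unit sphere as a measure on R^d carried by the sphere (for d = 1, the
   counting measure of {-1, 1}). *)
Definition surface_measure : {measure set (Rvec R d) -> \bar R} :=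
  mscale (d%:R)%:nng cone_measure.

End sphere.
Arguments unit_sphere {R} d.
Arguments surface_measure {R} d.

Section polynomials.
Context {R : realType} {d : nat}.
Local Notation C := R[i].
Implicit Types (x : Rvec R d) (f : mpoly d R[i]).

Definition ceval f x : C := meval (fun i => (tnth x i : R)%:C%C) f.

Definition reval (f : mpoly d R) x : R := meval (fun i => tnth x i : R) f.

Definition complexify (f : mpoly d R) : mpoly d R[i] :=
  map_mpoly (real_complex R) f.

Definition laplacian f : mpoly d R[i] := \sum_(i < d) mderiv i (mderiv i f).

(* 0 belongs to every harmonic_homog k *)
Definition harmonic_homog (k : nat) f : Prop :=
  f \is ishomog1 k (@mdeg d) /\ laplacian f = 0.

Definition normsq : mpoly d R[i] := \sum_(i < d) mpolyX C (mnm1 i) ^+ 2.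

(* p(|x|^2) *)
Definition radial (p : {poly C}) : mpoly d R[i] := horner_alg normsq p.

End polynomials.

Section basis.
Context {R : realType} {d : nat}.
Local Notation C := R[i].

(* The basis polynomials Y k l are given with real coefficients (they are real
   valued on R^d); they form a basis over C of the complex space
   harmonic_homog k, which thus has dimension a k. *)
Record harmonic_basis (a : nat -> nat)
    (Y : forall k, 'I_(a k) -> mpoly d R) : Prop := HarmonicBasis {
  basis_in : forall k l, harmonic_homog k (complexify (Y k l));
  basis_unique_coord : forall k (f : mpoly d R[i]), harmonic_homog k f ->
    exists! c : {ffun 'I_(a k) -> C},
      f = \sum_(l < a k) c l *: complexify (Y k l);
  basis_orthonormal : forall k (l l' : 'I_(a k)),
    \int[surface_measure d]_(x in unit_sphere d)
      (reval (Y k l) x * reval (Y k l') x) = (l == l')%:R }.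

End basis.

Section functional.
Context {R : realType} {d : nat} (a : nat -> nat).
Local Notation C := R[i].
Variables (Y : forall k, 'I_(a k) -> mpoly d R)
  (T : {scalar mpoly d R[i]}).

Definition laplace_component k (l : 'I_(a k)) (p : {poly C}) : C :=
  T (radial p * complexify (Y l)).

Definition poly_conj (p : {poly C}) : {poly C} := map_poly (@conjc R) p.

(* In C, 0 <= z means that z is real and nonnegative. *)
Definition pseudo_positive_definite : Prop :=
  forall k (l : 'I_(a k)) (p : {poly C}),
    0 <= laplace_component l (poly_conj p * p) /\
    0 <= laplace_component l ('X * (poly_conj p * p)).

End functional.

Section complex_integral.
Context {d'} {T : measurableType d'} {R : realType}.
Local Notation C := R[i].

Definition cintegrable (mu : set T -> \bar R) (D : set T) (f : T -> C) : Prop :=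
  mu.-integrable D (EFin \o (@complex.Re R) \o f) /\
  mu.-integrable D (EFin \o (@complex.Im R) \o f).

Definition cintegral (mu : {measure set T -> \bar R}) (D : set T)
    (f : T -> C) : C :=
  ((\int[mu]_(x in D) complex.Re (f x)) +i*
   (\int[mu]_(x in D) complex.Im (f x)))%C.

End complex_integral.

Section signed_measure.
Context {d'} {T : measurableType d'} {R : realType}.
Local Notation C := R[i].
Variable nu : {charge set T -> \bar R}.

Lemma hahn_exists :
  exists PN : set T * set T, hahn_decomposition nu PN.1 PN.2.
Proof. by have [P [N PN]] := Hahn_decomposition nu; exists (P, N). Qed.

Definition hahn_pair : hahn_decomposition nu _ _ := projT2 (cid hahn_exists).

Definition signed_variation : {measure set T -> \bar R} :=
  charge_variation hahn_pair.

Definition signed_integral (f : T -> R) : R :=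
  \int[jordan_pos hahn_pair]_x f x - \int[jordan_neg hahn_pair]_x f x.

Definition signed_cintegral (f : T -> C) : C :=
  (signed_integral (fun x => complex.Re (f x)) +i*
   signed_integral (fun x => complex.Im (f x)))%C.

End signed_measure.

Section moment_measure.
Context {R : realType} {d : nat}.
Variable mu : {charge set (Rvec R d) -> \bar R}.

Definition moment_measure : Prop :=
  forall f : mpoly d R[i], cintegrable (signed_variation mu) [set: _] (ceval f).

(* h is only used on [0, +oo[; its support is the closure of the set of
   the r >= 0 at which it does not vanish. *)
Definition pseudo_positive (a : nat -> nat)
    (Y : forall k, 'I_(a k) -> mpoly d R) : Prop :=
  forall h : R -> R,
    {within `[0, +oo[, continuous h} ->
    (forall r, 0 <= r -> 0 <= h r) ->
    compact (closure [set r : R | 0 <= r /\ h r != 0]) ->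
    forall k (l : 'I_(a k)),
      0 <= signed_integral mu (fun x => h (enorm x) * reval (Y k l) x).

End moment_measure.

Section summability.
Context {R : realType}.

(* r ^ (N - k) for r >= 0, with 0 ^ 0 = 1 and 0 ^ (- j) = +oo for j > 0 *)
Definition rpow_sub (N k : nat) (r : R) : \bar R :=
  if (k <= N)%N then (r ^+ (N - k))%:E
  else if r == 0 then +oo%E else (r ^- (k - N))%:E.

End summability.

(* Main.v *)
Require Import Defs.
From HB Require Import structures.
From mathcomp Require Import all_boot all_order all_algebra complex.
From mathcomp.multinomials Require mpoly.
Import -(notations) mpoly.
From mathcomp Require Import all_classical all_reals all_analysis.
From mathcomp Require Import measurable_realfun zify ring lra.

(** The measure is nu_+ - nu_-, where nu_+ and nu_- are the images under
    (r, theta) |-> r theta of the sum over k, l of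
    r^-k Y_kl^+ (resp. Y_kl^-) dtheta dsigma_kl(r).  Since |Y_kl| <= 1 + Y_kl^2
    has integral at most |S| + 1 on the sphere, summability makes all moments
    of nu_+ and nu_- finite.  By orthogonality of the Y_kl, the integral of
    h(|x|) Y_kl(x) against nu_+ - nu_- is that of h against sigma_kl, which
    gives pseudo-positivity, and, for h(r) = r^(2j), the moments of T on the
    polynomials |x|^(2j) Y_kl; these span by the Gauss decomposition.

    Orthogonality for different degrees comes from the divergence identity
    div ((s - |x|^2) (Q grad P - P grad Q)) = 2 (k' - k) P Q, for harmonic P, Q
    homogeneous of degrees k and k': the field vanishes where |x|^2 = s, so
    P Q has integral zero on every ball, hence on the sphere. *)

Set Implicit Arguments.
Unset Strict Implicit.
Unset Printing Implicit Defensive.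

Import Order.TTheory GRing.Theory Num.Theory.
Import numFieldNormedType.Exports.

Local Open Scope classical_set_scope.
Local Open Scope ring_scope.

(** The obstacle is that nu_+ and nu_- are given by infinite series of possibly infinite integrals,
    where signed terms cannot be rearranged. From the sphere on, positive and negative parts are
    therefore kept apart: identities relate sums of nonnegative terms in [\bar R], and subtraction
    is used only on quantities known to be finite. The surface measure is an image of Lebesgue
    measure on the punctured ball, so spherical integrals are integrals of [f (radial_proj x)] over
    that ball. Homogeneity, through the distribution of |x|^2, replaces integration in polar
    coordinates when passing from balls to the sphere. The two measures need not be mutually
    singular, whereas [signed_integral] is defined by the Jordan decomposition; the two are
    reconciled by domination. *)

(** * Laplacian, Euler identity and Gauss decomposition of polynomials *)

Section gauss.
Context {K : comNzRingType} {d : nat}.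
Implicit Types (f g : mpoly d K) (i : 'I_d).

(* laplacian and normsq are over C; these versions also apply to the real
   polynomials Y k l. *)
Definition lap f : mpoly d K := \sum_(i < d) mderiv i (mderiv i f).
Definition sqnorm : mpoly d K := \sum_(i < d) mpolyX K (mnm1 i) ^+ 2.

Lemma lap_is_linear : linear lap.
Proof.
move=> c f g; rewrite /lap scaler_sumr -big_split; apply: eq_bigr => i _ /=.
by rewrite !linearP.
Qed.
HB.instance Definition _ := GRing.isLinear.Build K (mpoly d K) (mpoly d K) _ lap
  lap_is_linear.

Lemma dhomog_deriv i k f :
  f \is ishomog1 k (@mdeg d) -> mderiv i f \is ishomog1 k.-1 (@mdeg d).
Proof.
move=> /dhomogP fk; apply/dhomogP => m; rewrite mcoeff_msupp mcoeff_deriv => mf.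
have /fk <- /= : mnm_add m (mnm1 i) \in msupp f.
  by rewrite mcoeff_msupp; apply: contra mf => /eqP ->; rewrite mul0rn.
by rewrite mdegD mdeg1 addn1.
Qed.

Lemma deriv_dhomog0 i f : f \is ishomog1 0 (@mdeg d) -> mderiv i f = 0.
Proof.
move=> /dhomogP f0; apply/mpolyP => m; rewrite mcoeff_deriv mcoeff0.
have [|/memN_msupp_eq0 ->] := boolP (mnm_add m (mnm1 i) \in msupp f); last first.
  by rewrite mul0rn.
by move=> /f0 /=; rewrite mdegD mdeg1 addn1.
Qed.

Lemma dhomog_lap k f :
  f \is ishomog1 k (@mdeg d) -> lap f \is ishomog1 k.-2 (@mdeg d).
Proof. by move=> fk; apply: rpred_sum => i _; do 2 apply: dhomog_deriv. Qed.

Lemma lap_dhomog_lt2 k f : (k < 2)%N -> f \is ishomog1 k (@mdeg d) -> lap f = 0.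
Proof.
move=> k2 fk; rewrite /lap big1// => i _; apply: deriv_dhomog0.
by move: (dhomog_deriv i fk); case: k k2 {fk} => [|[|]].
Qed.

Lemma mulX_deriv i m :
  mpolyX K (mnm1 i) * mderiv i (mpolyX K m) = (m i)%:R *: mpolyX K m.
Proof.
rewrite mderivX -scalerAr -mpolyXD.
have [->|mi] := eqVneq (m i) 0%N; first by rewrite !scale0r.
congr (_ *: mpolyX K _); apply/mnmP => j.
rewrite mnmDE mnmBE mnm1E; case: eqVneq => [<-|_]; rewrite ?add0n ?subn0//.
by rewrite subnKC// lt0n.
Qed.

Lemma euler_dhomog k f : f \is ishomog1 k (@mdeg d) ->
  \sum_(i < d) mpolyX K (mnm1 i) * mderiv i f = k%:R *: f.
Proof.
move=> /dhomogP fk; rewrite {2}(mpolyE f) scaler_sumr.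
transitivity (\sum_(i < d) \sum_(m <- msupp f)
    mcoeff m f *: ((m i)%:R *: mpolyX K m)).
  apply: eq_bigr => i _; rewrite {1}(mpolyE f) linear_sum mulr_sumr.
  by apply: eq_bigr => m _; rewrite linearZ -scalerAr mulX_deriv.
rewrite exchange_big; apply: eq_big_seq => m /fk /= <-.
by rewrite -scaler_sumr -scaler_suml -natr_sum -mdegE !scalerA mulrC.
Qed.

Lemma dhomog_sqnorm : sqnorm \is ishomog1 2 (@mdeg d).
Proof.
apply: rpred_sum => i _; rewrite expr2 -mpolyXD dhomogX /=.
by rewrite mdegD mdeg1.
Qed.

Lemma deriv_sqnorm i : mderiv i sqnorm = 2%:R *: mpolyX K (mnm1 i).
Proof.
have dX j : mderiv i (mpolyX K (mnm1 j)) = (j == i)%:R.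
  rewrite mderivX mnm1E; case: eqVneq => [->|_]; rewrite ?scale0r// scale1r.
  by rewrite -mpolyX0; congr mpolyX; apply/mnmP => l; rewrite mnmBE subnn mnm0E.
rewrite linear_sum (bigD1 i)//= big1 => [|j ji]; last first.
  by rewrite expr2 mderivM dX (negbTE ji) mul0r mulr0 addr0.
by rewrite expr2 mderivM dX eqxx mul1r mulr1 addr0 scaler_nat.
Qed.

(** Product rule: 2d is the Laplacian of |x|^2, and the cross term 4 x . grad f equals 4k f by
    Euler's identity. *)
Lemma lap_sqnormM k f : f \is ishomog1 k (@mdeg d) ->
  lap (sqnorm * f) = (2 * d + 4 * k)%:R *: f + sqnorm * lap f.
Proof.
move=> fk.
have dX i : mderiv i (mpolyX K (mnm1 i)) = 1.
  rewrite mderivX mnm1E eqxx scale1r.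
  by rewrite -mpolyX0; congr mpolyX; apply/mnmP => l; rewrite mnmBE subnn mnm0E.
have E i : mderiv i (mderiv i (sqnorm * f)) = 2%:R *: f
    + 4%:R *: (mpolyX K (mnm1 i) * mderiv i f) + sqnorm * mderiv i (mderiv i f).
  rewrite !(mderivM, mderivD, deriv_sqnorm, mderivZ) dX.
  have -> : 4%:R = 2%:R + 2%:R :> K by rewrite -natrD.
  by rewrite -!scalerAl mul1r (scalerDl _ 2%:R 2%:R) !addrA.
rewrite /lap (eq_bigr _ (fun i _ => E i)) !big_split/=.
rewrite -scaler_sumr sumr_const card_ord -scaler_sumr (euler_dhomog fk).
rewrite -mulr_sumr; congr (_ + _).
by rewrite scalerA -scaler_nat scalerA -scalerDl -!natrM -natrD mulnC.
Qed.

Lemma lap_sqnormXM j k f : f \is ishomog1 k (@mdeg d) -> lap f = 0 ->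
  lap (sqnorm ^+ j.+1 * f) =
  (2 * j.+1 * (d + 2 * k + 2 * j))%:R *: (sqnorm ^+ j * f).
Proof.
move=> fk lf; elim: j => [|j IH].
  by rewrite expr1 expr0 (lap_sqnormM fk) lf mulr0 addr0 mul1r; congr (_%:R *: _); lia.
rewrite exprS -mulrA (@lap_sqnormM (2 * j.+1 + k)); last first.
  by apply: dhomogM => //; apply: dhomogMn; exact: dhomog_sqnorm.
rewrite IH -scalerAr mulrA -exprS -scalerDl -natrD; congr (_%:R *: _); lia.
Qed.

End gauss.

(** Strong induction on the degree: the decomposition of [lap f], of degree k - 2, yields a [g]
    divisible by |x|^2 with the same Laplacian as [f]; then [f - g] is the harmonic component
    [h 0]. *)
Lemma gauss_decomposition (K : numFieldType) d (d0 : (0 < d)%N) k (f : mpoly d K) :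
  f \is ishomog1 k (@mdeg d) ->
  exists h : nat -> mpoly d K,
    (forall j, (2 * j <= k)%N ->
      h j \is ishomog1 (k - 2 * j) (@mdeg d) /\ lap (h j) = 0) /\
    f = \sum_(j < k./2.+1) sqnorm ^+ j * h j.
Proof.
elim/ltn_ind: k f => k IH f fk.
have [k2|] := ltnP k 2.
  exists (fun=> f); split.
    move=> j jk; have -> : j = 0%N by lia.
    by rewrite muln0 subn0; split=> //; exact: lap_dhomog_lt2 fk.
  rewrite (_ : k./2 = 0)%N; last by case: k k2 {IH fk} => [|[|]].
  by rewrite big_ord1 mul1r.
case: k IH fk => [//|[//|n]] IH fk _.
have [h [hh fE]] := IH n (leqnSn _) _ (dhomog_lap fk).
(* The factor of [lap_sqnormXM] for [h j], of degree n - 2j; it is nonzero because d > 0. *)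
pose c j : K := (2 * j.+1 * (d + 2 * (n - 2 * j) + 2 * j))%:R.
have c0 j : c j != 0 by rewrite pnatr_eq0 muln_eq0; lia.
pose g := \sum_(j < n./2.+1) sqnorm ^+ j.+1 * ((c j)^-1 *: h j).
have jn (j : 'I_n./2.+1) : (2 * j <= n)%N by have := ltn_ord j; lia.
exists (fun j => if j is j'.+1 then (c j')^-1 *: h j' else f - g); split.
  case=> [_|j jk].
    rewrite muln0 subn0; split.
      rewrite rpredB//; apply: rpred_sum => j _; have [hj _] := hh _ (jn j).
      rewrite (_ : n.+2 = (2 * j.+1) + (n - 2 * j))%N; last by have := jn j; lia.
      apply: dhomogM; last exact: rpredZ.
      by apply: dhomogMn; exact: dhomog_sqnorm.
    suff lg : lap g = lap f by rewrite linearB/= lg subrr.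
    rewrite fE linear_sum/=; apply: eq_bigr => j _; have [hj lj] := hh _ (jn j).
    rewrite -scalerAr linearZ/= (lap_sqnormXM _ hj lj) -/(c j) scalerA.
    by rewrite mulVf// scale1r.
  have [hj lj] := hh j ltac:(lia).
  rewrite (_ : n.+2 - 2 * j.+1 = n - 2 * j)%N; last lia.
  by split; [exact: rpredZ|rewrite linearZ/= lj scaler0].
by rewrite big_ord_recl/= mul1r subrK.
Qed.

(** * Integration over R^n along one coordinate *)

Section sections.
Context {R : realType}.

Definition upd n (x : Rvec R n) (i : 'I_n) (t : R) : Rvec R n :=
  [tuple if j == i then t else tnth x j | j < n].

Lemma tcons_upd0 n (x : Rvec R n) (s t : R) :
  upd (tcons (s, x)) ord0 t = tcons (t, x).
Proof.
apply: eq_from_tnth => j; rewrite tnth_mktuple; case: (unliftP ord0 j) => [k|] ->.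
  by rewrite !tnthS.
by rewrite eqxx.
Qed.

Lemma tcons_upd_lift n (x : Rvec R n) (s t : R) (i : 'I_n) :
  upd (tcons (s, x)) (lift ord0 i) t = tcons (s, upd x i t).
Proof.
apply: eq_from_tnth => j; rewrite tnth_mktuple; case: (unliftP ord0 j) => [k|] ->.
  by rewrite !tnthS/= tnth_mktuple (inj_eq lift_inj).
by [].
Qed.

(** Fubini, peeling off the first coordinate: if it is coordinate [i], it is integrated first;
    otherwise it is integrated last and induction applies to the remaining ones. *)
Lemma integral_sections0 n (i : 'I_n) (h : Rvec R n -> \bar R) :
  (lebesgue_tuple n).-integrable [set: Rvec R n] h ->
  (forall x, \int[lebesgue_measure]_t h (upd x i t) = 0)%E ->
  (\int[lebesgue_tuple n]_x h x = 0)%E.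
Proof.
elim: n i h => [|n IH] i h ih h0; first by case: i {h0}.
have mh := measurable_int _ ih.
pose mu := (@lebesgue_measure R \x @lebesgue_tuple R n)%E.
have ihc : mu.-integrable [set: _] (h \o @tcons R n).
  apply/integrableP; split; first exact: measurableT_comp.
  have /integrableP[_] := ih; apply: le_lt_trans.
  have /= <- // := @ge0_integral_pushforward _ _ _ _ _ _ (@measurable_tcons R n)
    mu setT (abse \o h).
  exact: measurableT_comp.
transitivity (\int[mu]_z (h (tcons z)))%E.
  exact: (@integral_pushforward _ _ _ _ _ _ (@measurable_tcons R n) mu setT).
case: (unliftP ord0 i) h0 => [j|] -> h0; last first.
  rewrite -integral21_prod_meas1// integral0_eq// => y _.
  rewrite -[RHS](h0 (tcons (0, y))); apply: eq_integral => t _.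
  by rewrite tcons_upd0.
rewrite -integral12_prod_meas1//.
(* The induction hypothesis wants an integrable section, available only for almost every first
   coordinate. *)
rewrite (@ae_eq_integral _ _ _ lebesgue_measure setT (cst 0%E))//.
- by rewrite integral_cst// mul0e.
- exact: (measurable_fubini_F ihc).
- have := ae_integrable1 ihc; apply: filterS => x ix _.
  apply: (IH j) => // y; rewrite -[RHS](h0 (tcons (x, y))).
  by apply: eq_integral => t _; rewrite tcons_upd_lift.
Qed.

Lemma measurable_box n (M : R) :
  measurable [set x : Rvec R n | forall i, `|tnth x i : R| <= M].
Proof.
rewrite (_ : [set _ | _] = \bigcap_(i in [set: 'I_n])
    (fun x : Rvec R n => tnth x i : R) @^-1` `[-M, M]).
  apply: fin_bigcap_measurable => // i _.
  by rewrite -[X in measurable X]setTI; apply: measurable_tnth.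
apply/seteqP; split => [x h i _|x h i].
  by rewrite /= in_itv/= -ler_norml.
by have := h i I; rewrite /= in_itv/= -ler_norml.
Qed.

Lemma lebesgue_tuple_box n (M : R) :
  (lebesgue_tuple n [set x : Rvec R n | forall i, `|tnth x i : R| <= M]%R < +oo)%E.
Proof.
elim: n => [|n IH].
  by rewrite /lebesgue_tuple/= diracE ltry.
rewrite /= /lebesgue_cons /pushforward.
rewrite (_ : _ @^-1` _ =
    `[-M, M] `*` [set x : Rvec R n | forall i, `|tnth x i : R| <= M]); last first.
  apply/seteqP; split => [[t x] /= h|[t x] /= [tM h] i].
    rewrite in_itv/= -ler_norml; split; first exact: (h ord0).
    by move=> i; have := h (lift ord0 i); rewrite tnthS.
  case: (unliftP ord0 i) => [j|] ->; first by rewrite tnthS; exact: h.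
  by move: tM; rewrite in_itv/= -ler_norml.
have mbox := @measurable_box n M.
have lM : (@lebesgue_measure R `[(- M)%R, M] < +oo)%E.
  by rewrite lebesgue_measure_itv/=; case: ifP => _; rewrite ltry.
by rewrite product_measure1E// lte_mul_pinfty// ge0_fin_numE.
Qed.

End sections.

(** * Divergence identity and orthogonality on balls *)

Section ball_integral.
Context {R : realType} {d : nat}.
Implicit Types (x : Rvec R d) (P Q G : mpoly d R) (i : 'I_d).

(** [P] on the line through [x] parallel to axis [i], kept as a univariate polynomial so that
    [mderiv i] becomes a formal derivative. *)
Definition secp i x P : {poly R} :=
  mmap polyC (fun j => if j == i then 'X else (tnth x j : R)%:P) P.

Lemma sqnormE x : reval sqnorm x = \sum_(i < d) (tnth x i : R) ^+ 2.
Proof.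
rewrite /reval /sqnorm raddf_sum; apply: eq_bigr => i _.
by rewrite /= !expr2 mevalM mevalXU.
Qed.

Lemma measurable_reval P : measurable_fun [set: Rvec R d] (reval P).
Proof.
rewrite (_ : reval P = fun x => \sum_(m <- msupp P)
    mcoeff m P * \prod_(i < d) (tnth x i : R) ^+ m i); last first.
  by apply/funext => x; rewrite /reval mevalE.
apply: measurable_sum => m; apply: measurable_funM => //.
apply: measurable_prod => i _; apply: measurable_funX.
exact: measurable_tnth.
Qed.

Lemma horner_secp i x t P : (secp i x P).[t] = reval P (upd x i t).
Proof.
elim/mpolyind: P => [|c m P _ _ IH]; first by rewrite /secp mmap0 horner0 /reval meval0.
rewrite /secp mmapD mmapZ mmapX -/(secp i x P) hornerD IH hornerCM.
rewrite /reval mevalD mevalZ mevalX /mmap1 horner_prod.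
congr (_ * _ + _); apply: eq_bigr => j _; rewrite horner_exp tnth_mktuple.
by case: ifP => _; rewrite ?hornerX ?hornerC.
Qed.

Lemma deriv_secp i x P : (secp i x P)^`() = secp i x (mderiv i P).
Proof.
elim/mpolyind: P => [|c m P _ _ IH]; first by rewrite /secp linear0 mmap0 deriv0.
rewrite /secp mderivD mderivZ !mmapD derivD IH !mmapZ mmapX; congr (_ + _).
rewrite mul_polyC derivZ mul_polyC; congr (_ *: _).
rewrite mderivX mmapZ mmapX /mmap1 (bigD1 i)//= [in RHS](bigD1 i)//= eqxx.
rewrite mnmBE mnm1E eqxx subn1.
rewrite (eq_bigr (fun j => ((tnth x j : R) ^+ m j)%:P)); last first.
  by move=> j ji; rewrite (negbTE ji) polyC_exp.
rewrite [in RHS](eq_bigr (fun j => ((tnth x j : R) ^+ m j)%:P)); last first.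
  by move=> j ji; rewrite mnmBE mnm1E (eq_sym i) (negbTE ji) subn0 polyC_exp.
rewrite -rmorph_prod/= derivM derivC mulr0 addr0 derivXn.
by rewrite mulrA polyC_natr mulr_natl.
Qed.

(** Indexing by the squared radius makes s - |x|^2, which vanishes on the boundary, a polynomial. *)
Definition sqball (s : R) : set (Rvec R d) := [set x | reval sqnorm x <= s].

Lemma measurable_sqball s : measurable (sqball s).
Proof.
rewrite (_ : sqball s = reval sqnorm @^-1` `]-oo, s]); last first.
  by apply/seteqP; split => x; rewrite /sqball /= in_itv.
by rewrite -[X in measurable X]setTI; apply: measurable_reval.
Qed.

Lemma sqball_coord s x : sqball s x -> forall i, `|tnth x i : R| <= 1 + s.
Proof.
rewrite /sqball /= sqnormE => xs i.
have {xs} : (tnth x i : R) ^+ 2 <= s.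
  by apply: le_trans xs; rewrite (bigD1 i)//= lerDl sumr_ge0// => j _; exact: sqr_ge0.
(* From y^2 <= s: |y| <= (1 + y^2) / 2 <= 1 + s, without square roots. *)
by rewrite ler_norml; move: (tnth x i : R) => y; nra.
Qed.

Lemma sqball_finite s : (lebesgue_tuple d (sqball s) < +oo)%E.
Proof.
apply: le_lt_trans (lebesgue_tuple_box d (1 + s)).
apply: le_measure; rewrite ?inE.
- exact: measurable_sqball.
- exact: measurable_box.
- exact: sqball_coord.
Qed.

Lemma reval_bounded s P : exists M, forall x, sqball s x -> `|reval P x| <= M.
Proof.
exists (\sum_(m <- msupp P) `|mcoeff m P| * \prod_(i < d) (1 + s) ^+ m i) => x xs.
rewrite /reval mevalE; apply: le_trans (ler_norm_sum _ _ _) _.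
apply: ler_sum => m _; rewrite normrM ler_wpM2l// normr_prod.
apply: ler_prod => i _; rewrite normrX exprn_ge0//=.
by apply: lerXn2r; rewrite ?nnegrE ?(le_trans _ (sqball_coord xs i)) ?sqball_coord.
Qed.

Lemma integrable_reval s P :
  (lebesgue_tuple d).-integrable (sqball s) (EFin \o reval P).
Proof.
have [M PM] := reval_bounded s P.
apply: measurable_bounded_integrable.
- exact: measurable_sqball.
- exact: sqball_finite.
- by apply: measurable_funTS; exact: measurable_reval.
- exists M; split; first exact: num_real.
  by move=> N MN x xs /=; rewrite (le_trans (PM _ xs))// ltW.
Qed.

Lemma integral_deriv_sym (p : {poly R}) (a : R) : 0 <= a ->
  (\int[lebesgue_measure]_(t in `[(- a)%R, a]) (p^`().[t])%:E = (p.[a] - p.[- a])%:E)%E.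
Proof.
rewrite le_eqVlt => /predU1P[<-|a0].
  by rewrite oppr0 set_itv1 integral_set1 subrr.
rewrite (@continuous_FTC2 _ _ (horner p))//.
- by rewrite gtrN.
- apply: continuous_subspaceT; exact: continuous_horner.
- split=> [x _||]; first exact: derivable_horner.
  + by apply: cvg_at_right_filter; exact: continuous_horner.
  + by apply: cvg_at_left_filter; exact: continuous_horner.
- by move=> x _; rewrite -derivE.
Qed.

(** A line parallel to axis [i] either misses the ball or meets it in |t| <= sqrt (s - c), with c
    the sum of the other squared coordinates. The integrand there is the derivative of a polynomial
    that vanishes at both ends. *)
Lemma integral_deriv_sqball i s G :
  (\int[lebesgue_tuple d]_(x in sqball s)
    (reval (mderiv i ((mpolyC d s - sqnorm) * G)) x)%:E = 0)%E.
Proof.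
rewrite integral_mkcond; apply: (@integral_sections0 _ _ i).
  rewrite -integrable_mkcond; first exact: integrable_reval.
  exact: measurable_sqball.
move=> x; pose c := \sum_(j < d | j != i) (tnth x j : R) ^+ 2.
have nE t : reval sqnorm (upd x i t) = t ^+ 2 + c.
  rewrite sqnormE (bigD1 i)//= tnth_mktuple eqxx; congr (_ + _).
  by apply: eq_bigr => j ji; rewrite tnth_mktuple (negbTE ji).
pose p := secp i x ((mpolyC d s - sqnorm) * G).
have pE t : p.[t] = (s - (t ^+ 2 + c)) * reval G (upd x i t).
  by rewrite horner_secp {1}/reval mevalM mevalB mevalC -nE.
have [sc|cs] := ltP s c.
  rewrite integral0_eq// => t _; rewrite patchE ifF//.
  apply/negP; rewrite inE /sqball /= nE => ts.
  by have := sqr_ge0 t; lra.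
transitivity (\int[lebesgue_measure]_(t in `[(- Num.sqrt (s - c))%R, Num.sqrt (s - c)])
    (p^`().[t])%:E)%E; last first.
  rewrite integral_deriv_sym ?sqrtr_ge0// !pE sqrrN.
  by rewrite sqr_sqrtr ?subr_ge0// subrK subrr !mul0r subrr.
rewrite [RHS]integral_mkcond; apply: eq_integral => t _; rewrite !patchE deriv_secp horner_secp.
congr (if _ then _ else _); apply/idP/idP; rewrite !inE /sqball /= nE in_itv/=.
  move=> ts; rewrite -ler_norml -sqrtr_sqr ler_wsqrtr//; lra.
rewrite -ler_norml -sqrtr_sqr ler_sqrt ?subr_ge0//; lra.
Qed.

Lemma harmonic_orthogonal_sqball k k' P Q s : k != k' ->
  P \is ishomog1 k (@mdeg d) -> lap P = 0 ->
  Q \is ishomog1 k' (@mdeg d) -> lap Q = 0 ->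
  (\int[lebesgue_tuple d]_(x in sqball s) (reval (P * Q) x)%:E = 0)%E.
Proof.
move=> kk' hP lP hQ lQ.
pose c : R := 2 * (k'%:R - k%:R).
have c0 : c != 0 by rewrite mulf_neq0// subr_eq0 eqr_nat eq_sym.
have divE : c *: (P * Q) = \sum_(i < d)
    mderiv i ((mpolyC d s - sqnorm) * (Q * mderiv i P - P * mderiv i Q)).
  (* Summed over [i], the first term becomes Q lap P - P lap Q = 0; the second comes from the
     gradient of |x|^2 and is evaluated by Euler's identity. *)
  have E i : mderiv i ((mpolyC d s - sqnorm) * (Q * mderiv i P - P * mderiv i Q))
    = (mpolyC d s - sqnorm) * (Q * mderiv i (mderiv i P) - P * mderiv i (mderiv i Q))
      - 2%:R *: (Q * (mpolyX R (mnm1 i) * mderiv i P) - P * (mpolyX R (mnm1 i) * mderiv i Q)).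
    rewrite !(mderivM, mderivB) mderivC deriv_sqnorm -!mul_mpolyC; ring.
  rewrite (eq_bigr _ (fun i _ => E i)) sumrB -mulr_sumr sumrB -!mulr_sumr.
  rewrite -/(lap P) -/(lap Q) lP lQ !mulr0 subrr mulr0 -scaler_sumr sumrB -!mulr_sumr.
  rewrite (euler_dhomog hP) (euler_dhomog hQ) sub0r -!mul_mpolyC /c.
  rewrite !(mpolyCM, mpolyCB); ring.
rewrite (eq_integral (fun x => (c^-1)%:E * \sum_(i < d) (reval (mderiv i
    ((mpolyC d s - sqnorm) * (Q * mderiv i P - P * mderiv i Q))) x)%:E)%E).
  rewrite integralZl//; [|exact: measurable_sqball|]; last first.
    apply: integrable_sum => [|i _]; first exact: measurable_sqball.
    exact: integrable_reval.
  rewrite integral_sum; [|exact: measurable_sqball|by move=> i; exact: integrable_reval].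
  by rewrite big1 ?mule0// => i _; rewrite integral_deriv_sqball.
move=> x _; rewrite sumEFin -EFinM; congr EFin.
have : reval (c *: (P * Q)) x = \sum_(i < d) reval (mderiv i
    ((mpolyC d s - sqnorm) * (Q * mderiv i P - P * mderiv i Q))) x.
  by rewrite divE /reval raddf_sum.
by rewrite {1}/reval mevalZ => <-; rewrite mulKf.
Qed.

End ball_integral.

(** * Images, sums and differences of measures *)

Section measures.
Context {R : realType}.
Local Open Scope ereal_scope.

Lemma ge0_integral_mrestr d (T : measurableType d) (m : {measure set T -> \bar R})
    (D : set T) (mD : measurable D) (f : T -> \bar R) :
  measurable_fun [set: T] f -> (forall x, 0 <= f x) ->
  \int[mrestr m mD]_x f x = \int[m]_(x in D) f x.
Proof.
move=> mf f0.
have mDC : measurable (~` D) by exact: measurableC.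
rewrite (ge0_negligible_integral mDC measurableT mf)//; last first.
  by rewrite /= /mrestr setICl.
rewrite setTD setCK; apply: eq_measure_integral => A mA AD.
by rewrite /= /mrestr setIidl.
Qed.

(* nu is the image of the product of m with Lebesgue measure restricted to the
   subgraph of g: this avoids building a measure with density g. *)
Lemma weighted_image d d' (X : measurableType d) (Y : measurableType d')
    (m : {sigma_finite_measure set X -> \bar R}) (phi : X -> Y) (g : X -> R) :
  measurable_fun [set: X] phi -> measurable_fun [set: X] g ->
  (forall x, 0 <= g x)%R ->
  exists nu : {measure set Y -> \bar R}, forall f : Y -> \bar R,
    measurable_fun [set: Y] f -> (forall y, 0 <= f y) ->
    \int[nu]_y f y = \int[m]_x (f (phi x) * (g x)%:E).
Proof.
move=> mphi mg g0.
pose sub := [set z : X * measurableTypeR R | (0 <= z.2 < g z.1)%R].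
have mg1 : measurable_fun [set: X * measurableTypeR R] (fun z => g z.1).
  exact: measurableT_comp.
have msub : measurable sub.
  have -> : sub = [set z | 0%R <= z.2]%R `&` [set z | z.2 < g z.1]%R.
    by apply/seteqP; split => z; rewrite /sub/=; [move/andP|move=> ?; apply/andP].
  apply: measurableI.
    rewrite -[X in measurable X]setTI.
    exact: (@measurable_fun_le _ _ _ setT (cst 0%R) snd).
  have -> : [set z : X * measurableTypeR R | z.2 < g z.1]%R =
      [set: _] `&` [set z | (z.2)%:E < (g z.1)%:E].
    by rewrite setTI; apply/seteqP; split => z; rewrite /= lte_fin.
  apply: measurable_lte => //; last exact/measurable_EFinP.
  by apply/measurable_EFinP; exact: measurable_snd.
pose q := mrestr (m \x @lebesgue_measure R) msub.
have mphi1 : measurable_fun [set: X * measurableTypeR R] (phi \o fst).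
  exact: measurableT_comp.
exists (pushforward q (phi \o fst)) => f mf f0.
rewrite (ge0_integral_pushforward mphi1)//= preimage_setT.
rewrite ge0_integral_mrestr//; last exact: (measurableT_comp mf mphi1).
rewrite integral_mkcond.
rewrite (fubini_tonelli1 (fun z => ((f \o (phi \o fst)) \_ sub) z)); last 2 first.
- apply/(measurable_restrictT _ _).1 => //.
  by apply: measurable_funTS; exact: (measurableT_comp mf mphi1).
- by move=> z; apply: erestrict_ge0 => y _; exact: f0.
apply: eq_integral => x _.
transitivity (\int[lebesgue_measure]_(t in `[0%R, g x[) f (phi x)).
  rewrite [RHS]integral_mkcond; apply: eq_integral => t _.
  have xt : ((x, t) \in sub) = (t \in `[0%R, g x[%classic).
    by apply/idP/idP => /set_mem h; apply/mem_set; move: h; rewrite /sub/= in_itv.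
  by rewrite !patchE xt.
have gE : @lebesgue_measure R `[0%R, g x[ = (g x)%:E.
  rewrite lebesgue_measure_itv/= lte_fin; case: ltP => gx; first by rewrite sube0.
  by congr EFin; apply/eqP; rewrite eq_le gx g0.
rewrite integral_cst//; congr (_ * _); exact: gE.
Unshelve. exact: mphi1.
Qed.

Lemma sigma_finite_product d1 d2 (T1 : measurableType d1) (T2 : measurableType d2)
    (m1 : {sigma_finite_measure set T1 -> \bar R})
    (m2 : {sigma_finite_measure set T2 -> \bar R}) :
  sigma_finite setT (m1 \x m2).
Proof.
have /sigma_finiteP[F [FT ndF Foo]] := sigma_finiteT m1.
have /sigma_finiteP[G [GT ndG Goo]] := sigma_finiteT m2.
exists (fun n => F n `*` G n) => [|n].
  apply/esym; rewrite -subTset => -[x y] _.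
  have [i _ Fx] : (\bigcup_i F i) x by rewrite -FT.
  have [j _ Gy] : (\bigcup_i G i) y by rewrite -GT.
  exists (maxn i j) => //; split.
    by move: x Fx; exact/subsetPset/ndF/leq_maxl.
  by move: y Gy; exact/subsetPset/ndG/leq_maxr.
have [[mF Fn] [mG Gn]] := (Foo n, Goo n); split; first exact: measurableX.
by rewrite product_measure1E// lte_mul_pinfty// ge0_fin_numE.
Qed.

Lemma integral_sum_measure d (T : measurableType d) n
    (m : 'I_n -> {measure set T -> \bar R}) :
  exists nu : {measure set T -> \bar R}, forall f : T -> \bar R,
    measurable_fun [set: T] f -> (forall y, 0 <= f y) ->
    \int[nu]_y f y = \sum_(i < n) \int[m i]_y f y.
Proof.
pose m' i : {measure set T -> \bar R} := if insub i is Some j then m j else mzero.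
exists (msum m' n) => f mf f0; rewrite ge0_integral_measure_sum//.
by apply: eq_bigr => i _; rewrite /m' valK.
Qed.

Lemma finite_measure_of d (T : measurableType d) (m : {measure set T -> \bar R}) :
  m setT < +oo ->
  exists m' : {finite_measure set T -> \bar R}, forall A, m' A = m A.
Proof.
move=> moo; exists (mfrestr measurableT moo) => A.
by rewrite /= /mfrestr /mrestr setIT.
Qed.

(** On [A] the positive part is the value of [nu] on the part of [A] inside [P], to which the bound
    by [m] applies. *)
Lemma jordan_pos_le d (T : measurableType d) (nu : {charge set T -> \bar R}) P N
    (nuPN : hahn_decomposition nu P N) (m : {measure set T -> \bar R}) :
  (forall A, measurable A -> nu A <= m A) ->
  forall A, measurable A -> jordan_pos nuPN A <= m A.
Proof.
move=> num A mA; have [[mP _] _ _ _] := nuPN.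
rewrite jordan_posE cjordan_posE /crestr0 mem_set// /crestr/=.
have mAP : measurable (A `&` P) by exact: measurableI.
apply: le_trans (num _ mAP) _.
by apply: le_measure; rewrite ?inE//; exact: subIsetl.
Qed.

Lemma jordan_neg_le d (T : measurableType d) (nu : {charge set T -> \bar R}) P N
    (nuPN : hahn_decomposition nu P N) (m : {measure set T -> \bar R}) :
  (forall A, measurable A -> - nu A <= m A) ->
  forall A, measurable A -> jordan_neg nuPN A <= m A.
Proof.
move=> num A mA; have [_ [mN _] _ _] := nuPN.
rewrite jordan_negE cjordan_negE /crestr0 mem_set// /crestr/=.
have mAN : measurable (A `&` N) by exact: measurableI.
apply: le_trans (num _ mAN) _.
by apply: le_measure; rewrite ?inE//; exact: subIsetl.
Qed.

(** The Jordan parts of n1 - n2 are dominated by [n1] and [n2], so integrability passes to them.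
    Values are compared through the equality of measures [jp] + n2 = [jn] + n1, which involves no
    subtraction. *)
Lemma signed_integral_diff d (T : measurableType d)
    (n1 n2 : {finite_measure set T -> \bar R}) :
  exists mu : {charge set T -> \bar R}, forall f : T -> R,
    n1.-integrable [set: T] (EFin \o f) -> n2.-integrable [set: T] (EFin \o f) ->
    (signed_variation mu).-integrable [set: T] (EFin \o f) /\
    (signed_integral mu f = \int[n1]_x f x - \int[n2]_x f x)%R.
Proof.
pose mu : {charge set T -> \bar R} :=
  cadd (charge_of_finite_measure n1) (copp (charge_of_finite_measure n2)).
exists mu => f i1 i2.
have muE A : mu A = n1 A - n2 A by [].
have mf := measurable_int _ i1.
set jp := jordan_pos (hahn_pair mu); set jn := jordan_neg (hahn_pair mu).
have fin1 A : measurable A -> n1 A \is a fin_num by exact: fin_num_measure.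
have fin2 A : measurable A -> n2 A \is a fin_num by exact: fin_num_measure.
have jp_le : forall A, measurable A -> jp A <= n1 A.
  by apply: jordan_pos_le => A mA; rewrite muE geeDl// oppe_le0.
have jn_le : forall A, measurable A -> jn A <= n2 A.
  apply: jordan_neg_le => A mA; rewrite muE.
  by rewrite fin_num_oppeB ?fin2// geeDr// oppe_le0.
have jE A : measurable A -> jp A + n2 A = jn A + n1 A.
  move=> mA; have : n1 A - n2 A = jp A - jn A.
    by rewrite -muE (jordan_decomp (hahn_pair mu) mA) /cadd/= cscaleN1.
  have jpf : jp A \is a fin_num by exact: fin_num_measure.
  have jnf : jn A \is a fin_num by exact: fin_num_measure.
  move: (fin1 _ mA) (fin2 _ mA) jpf jnf; clearbody jp jn.
  case: (n1 A) => // a; case: (n2 A) => // b; case: (jp A) => // c; case: (jn A) => // e.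
  by move=> _ _ _ _ []; rewrite -!EFinD => h; congr EFin; lra.
have le_int (m1 m2 : {measure set T -> \bar R}) :
    (forall A, measurable A -> m1 A <= m2 A) ->
    m2.-integrable setT (EFin \o f) -> m1.-integrable setT (EFin \o f).
  move=> m12 /integrableP[_ foo]; apply/integrableP; split=> //.
  apply: le_lt_trans foo; apply: ge0_le_measure_integral => //.
  exact: measurableT_comp.
have ijp := le_int _ _ jp_le i1; have ijn := le_int _ _ jn_le i2.
split.
  apply/integrableP; split=> //.
  apply: (@le_lt_trans _ _ (\int[measure_add n1 n2]_x `|(f x)%:E|)).
    apply: ge0_le_measure_integral => //; last exact: measurableT_comp.
    move=> A mA; rewrite [leRHS]measure_addE.
    by apply: leeD; [exact: jp_le|exact: jn_le].
  rewrite ge0_integral_measure_add//; last exact: measurableT_comp.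
  by have /integrableP[_ ?] := i1; have /integrableP[_ ?] := i2; exact: lte_add_pinfty.
have : \int[measure_add jp n2]_x (f x)%:E = \int[measure_add jn n1]_x (f x)%:E.
  apply: eq_measure_integral => A mA _ /=.
  by rewrite [LHS]measure_addE [RHS]measure_addE; exact: jE.
rewrite !integral_measure_add// /signed_integral /Rintegral -/jp -/jn.
have f1 := integrable_fin_num measurableT i1.
have f2 := integrable_fin_num measurableT i2.
have f3 := integrable_fin_num measurableT ijp.
have f4 := integrable_fin_num measurableT ijn.
rewrite -(fineK f1) -(fineK f2) -(fineK f3) -(fineK f4) -!EFinD => -[] h.
by rewrite /=; lra.
Qed.

End measures.

(** * From balls to the sphere, by homogeneity *)

Section sphere_integrals.
Context {R : realType} {d : nat}.
Implicit Types (x : Rvec R d) (P Q W : mpoly d R).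

Definition dilate (r : R) x : Rvec R d := [tuple r * (tnth x i : R) | i < d].

Lemma reval_dilate k P r x : P \is ishomog1 k (@mdeg d) ->
  reval P (dilate r x) = r ^+ k * reval P x.
Proof.
move=> /dhomogP Pk; rewrite /reval !mevalE mulr_sumr; apply: eq_big_seq => m /Pk /= <-.
rewrite mulrCA; congr (_ * _); rewrite mdegE -prodrXr -big_split/=.
by apply: eq_bigr => i _; rewrite tnth_mktuple exprMn.
Qed.

Lemma enorm_ge0 x : 0 <= enorm x. Proof. exact: sqrtr_ge0. Qed.

Lemma sqr_enorm x : enorm x ^+ 2 = reval sqnorm x.
Proof. by rewrite sqnormE sqr_sqrtr// sumr_ge0// => i _; exact: sqr_ge0. Qed.

Lemma enorm_dilate r x : enorm (dilate r x) = `|r| * enorm x.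
Proof.
apply/eqP; rewrite -(@eqrXn2 _ 2) ?mulr_ge0 ?enorm_ge0//.
rewrite exprMn !sqr_enorm (reval_dilate _ _ (@dhomog_sqnorm R d)).
by rewrite -normrX ger0_norm// sqr_ge0.
Qed.

Lemma radial_projE x : radial_proj x = dilate (enorm x)^-1 x.
Proof. by apply: eq_from_tnth => i; rewrite !tnth_mktuple mulrC. Qed.

Lemma enorm_radial_proj x : 0 < enorm x -> enorm (radial_proj x) = 1.
Proof.
move=> x0; rewrite radial_projE enorm_dilate gtr0_norm ?invr_gt0//.
by rewrite mulVf// gt_eqF.
Qed.

Lemma dhomog_reval0 k P x : (0 < k)%N -> P \is ishomog1 k (@mdeg d) ->
  enorm x = 0 -> reval P x = 0.
Proof.
move=> k0 Pk /eqP; rewrite -sqrf_eq0 sqr_enorm sqnormE psumr_eq0; last first.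
  by move=> i _; exact: sqr_ge0.
move=> /allP x0; have -> : x = dilate 0 x.
  apply: eq_from_tnth => i; rewrite tnth_mktuple mul0r.
  by have := x0 i (mem_index_enum i); rewrite sqrf_eq0 => /eqP.
by rewrite (reval_dilate _ _ Pk) expr0n gtn_eqF// mul0r.
Qed.

Local Open Scope ereal_scope.

(** [radial_proj] sends the whole punctured ball into the sphere, so restricting the image measure
    to the sphere loses nothing. *)
Lemma ge0_integral_surface (f : Rvec R d -> \bar R) :
  measurable_fun [set: Rvec R d] f -> (forall x, 0 <= f x) ->
  \int[surface_measure d]_(x in unit_sphere d) f x =
  (d%:R)%:E * \int[lebesgue_tuple d]_(x in punctured_ball) f (radial_proj x).
Proof.
move=> mf f0.
have mS : measurable (unit_sphere d : set (Rvec R d)).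
  rewrite (_ : unit_sphere d = @enorm R d @^-1` [set 1%R]); last by [].
  by rewrite -[_ @^-1` _]setTI; exact: measurable_enorm.
rewrite ge0_integral_mscale//; last exact: measurable_funTS.
congr (_ * _); rewrite (ge0_integral_pushforward measurable_radial_proj)//; last first.
  exact: measurable_funTS.
rewrite integral_mkcond ge0_integral_mrestr; last 2 first.
- apply/(measurable_restrictT _ _).1.
    by rewrite -[_ @^-1` _]setTI; exact: measurable_radial_proj.
  apply: measurable_funTS; exact: (measurableT_comp mf measurable_radial_proj).
- by move=> x; apply: erestrict_ge0 => y _; exact: f0.
apply: eq_integral => x; rewrite inE => -/andP[x0 _].
by rewrite patchE mem_set//=; exact: enorm_radial_proj.
Qed.

(* The images of W^+ and W^- on the unit ball under x |-> - |x|^2 agree on the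
   half-lines [s, +oo[, hence are equal; both sides are then the integral of the
   same radial weight |x|^-k. *)
Lemma sphere_posneg k W : (0 < k)%N -> W \is ishomog1 k (@mdeg d) ->
  (forall s, \int[lebesgue_tuple d]_(x in sqball s) (reval W x)%:E = 0) ->
  \int[lebesgue_tuple d]_(x in punctured_ball)
    (Num.max (reval W (radial_proj x)) 0)%:E =
  \int[lebesgue_tuple d]_(x in punctured_ball)
    (Num.max (- reval W (radial_proj x)) 0)%:E.
Proof.
move=> k0 hW W0.
have mmax (e : R) : measurable_fun [set: Rvec R d] (fun x => Num.max (e * reval W x)%R 0%R).
  apply: measurable_maxr => //; apply: measurable_funM => //; exact: measurable_reval.
have mI s : measurable_fun [set: Rvec R d] (\1_(sqball s) : Rvec R d -> R).
  by apply: measurable_indic; exact: measurable_sqball.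
have mN : measurable_fun [set: Rvec R d] (fun x => (- reval sqnorm x)%R).
  by apply: measurableT_comp => //; exact: measurable_reval.
(* The sign in - |x|^2 turns balls into half-lines [s, +oo[, which generate the Borel sets; the
   minimum with 1 comes from the density being cut off at the unit ball. *)
have key (e : R) : exists nu : {measure set (measurableTypeR R) -> \bar R},
    (forall s, nu `[s, +oo[%classic = \int[lebesgue_tuple d]_(x in sqball (Num.min (- s) 1)%R)
       (Num.max (e * reval W x) 0)%:E) /\
    \int[nu]_t ((Num.sqrt (- t) ^- k)%R)%:E = \int[lebesgue_tuple d]_(x in punctured_ball)
       (Num.max (e * reval W (radial_proj x)) 0)%:E.
  have [||nu nuE] := @weighted_image R _ _ _ _ (lebesgue_tuple d)
      (fun x => (- reval sqnorm x)%R : measurableTypeR R)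
      (fun x => Num.max (e * reval W x) 0 * \1_(sqball 1) x)%R mN.
  - exact: measurable_funM.
  - by move=> x; rewrite mulr_ge0// le_max lexx orbT.
  exists nu; split=> [s|].
    have := nuE (fun t => (\1_(`[s, +oo[%classic) t)%:E).
    rewrite integral_indic// setIT => ->.
    - rewrite [RHS]integral_mkcond; apply: eq_integral => x _.
      rewrite patchE !indicE -!EFinM.
      have -> : (x \in sqball (Num.min (- s) 1)%R) =
          ((- reval sqnorm x)%R \in `[s, +oo[%classic) && (x \in sqball 1).
        apply/idP/andP.
          rewrite inE /sqball/= le_min => /andP[xs x1].
          by split; apply/mem_set => //=; rewrite in_itv/= andbT lerNr.
        move=> [/set_mem/= + /set_mem]; rewrite in_itv/= andbT => xs x1.
        by apply/mem_set; rewrite /sqball/= le_min lerNr xs.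
      by do 2 case: (_ \in _); rewrite ?(mul1r, mulr1, mul0r, mulr0).
    - by apply/measurable_EFinP; exact: measurable_indic.
    - by move=> t; rewrite lee_fin.
  rewrite nuE.
  - rewrite [RHS]integral_mkcond; apply: eq_integral => x _.
    rewrite patchE opprK -EFinM indicE.
    have nE : Num.sqrt (reval sqnorm x) = enorm x by rewrite sqnormE.
    rewrite nE.
    (* At the origin the weight is 1 / 0 = 0 since k > 0, which matches its exclusion from the
       punctured ball. *)
    have [x0|x0] := eqVneq (enorm x) 0%R.
      rewrite x0 expr0n gtn_eqF// invr0 mul0r ifF//.
      by apply/negP => /set_mem; rewrite /punctured_ball/= x0 ltxx.
    have xp : (0 < enorm x)%R by rewrite lt0r x0 enorm_ge0.
    have -> : (x \in punctured_ball) = (x \in sqball 1).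
      apply/idP/idP => /set_mem h; apply/mem_set; move: h; rewrite /punctured_ball/sqball/=.
        by move=> /andP[_ x1]; rewrite -sqr_enorm expr_le1 ?enorm_ge0.
      by rewrite xp -sqr_enorm expr_le1 ?enorm_ge0.
    case: ifP => _; last by rewrite mulr0 mulr0.
    rewrite mulr1 radial_projE (reval_dilate _ _ hW) exprVn.
    have kp : (0 <= (enorm x ^+ k)^-1)%R by rewrite invr_ge0 exprn_ge0// enorm_ge0.
    by rewrite maxr_pMr// mulr0 mulrCA.
  - apply/measurable_EFinP.
    rewrite (_ : (fun t => _) = fun t => Num.sqrt (- t) `^ (- k%:R))%R; last first.
      by apply/funext => t; rewrite powRN powR_mulrn ?sqrtr_ge0.
    apply: (@measurableT_comp _ _ _ _ _ _ (@powR R ^~ (- k%:R)%R)).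
      exact: measurable_powR.
    apply: (@measurableT_comp _ _ _ _ _ _ (@Num.sqrt R)).
      by apply: continuous_measurable_fun; exact: sqrt_continuous.
    by apply: measurable_funN; exact: measurable_id.
  - by move=> t; rewrite lee_fin invr_ge0 exprn_ge0// sqrtr_ge0.
have wpos (e : R) s : (\int[lebesgue_tuple d]_(x in sqball s) (Num.max (e * reval W x) 0)%:E)
    \is a fin_num.
  have [M WM] := reval_bounded s W.
  have iW : (lebesgue_tuple d).-integrable (sqball s)
      (EFin \o (fun x => Num.max (e * reval W x) 0)%R).
    apply: measurable_bounded_integrable.
    - exact: measurable_sqball.
    - exact: sqball_finite.
    - exact: measurable_funTS.
    - exists (`|e| * M)%R; split; first exact: num_real.
      move=> N MN x xs /=; rewrite (le_trans _ (ltW MN))//.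
      apply: (@le_trans _ _ `|e * reval W x|%R); last first.
        by rewrite normrM ler_wpM2l// WM.
      by case: (leP (e * reval W x)%R) => // _; rewrite normr0.
  exact: (integrable_fin_num (measurable_sqball s) iW).
have [nu1 [nu1s nu1E]] := key 1%R; have [nu2 [nu2s nu2E]] := key (-1)%R.
under eq_integral do rewrite -[reval _ _]mul1r.
under [RHS]eq_integral do rewrite -mulN1r.
rewrite -nu1E -nu2E; apply: eq_measure_integral => A mA _.
(* The half-lines are stable under intersection, and the [-n, +oo[ have finite mass and exhaust the
   line. *)
apply: (@measure_unique _ R (measurableTypeR R) (@RGenCInfty.G R) (fun n => `[(- n%:R)%R, +oo[%classic)
   (RGenCInfty.measurableE R) _ _ _ nu1 nu2 _ _ A mA) => //.
- move=> _ _ [s ->] [t ->]; exists (Num.max s t) => //.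
  apply/seteqP; split=> r /=; rewrite !in_itv/= !andbT ge_max => /andP.
    by [].
  by [].
- by move=> n; exists (- n%:R)%R.
- apply/seteqP; split=> // r _; exists (Num.truncn `|r|).+1 => //=.
  rewrite in_itv/= andbT lerNl; apply: ltW.
  by rewrite (le_lt_trans (ler_norm _))// normrN truncnS_gt.
- move=> _ [s ->]; rewrite nu1s nu2s; set r := Num.min _ _.
  have := W0 r; rewrite integralE.
  have -> : \int[lebesgue_tuple d]_(x in sqball r) (fun x => (reval W x)%:E)^\+ x =
      \int[lebesgue_tuple d]_(x in sqball r) (Num.max (1 * reval W x) 0)%:E.
    by apply: eq_integral => x _; rewrite funeposE mul1r EFin_max.
  have -> : \int[lebesgue_tuple d]_(x in sqball r) (fun x => (reval W x)%:E)^\- x =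
      \int[lebesgue_tuple d]_(x in sqball r) (Num.max (-1 * reval W x) 0)%:E.
    by apply: eq_integral => x _; rewrite funenegE mulN1r EFin_max EFinN.
  rewrite -(fineK (wpos 1%R r)) -(fineK (wpos (-1)%R r)) -EFinB => -[/eqP].
  by rewrite subr_eq0 => /eqP ->.
- move=> n; rewrite nu1s -ge0_fin_numE; first exact: wpos.
  by apply: integral_ge0 => x _; rewrite lee_fin le_max lexx orbT.
Qed.

End sphere_integrals.

(** * Real polynomials seen as complex ones *)

Section complexification.
Context {R : realType} {d : nat}.
Implicit Types P : mpoly d R.

Lemma mcoeff_complexify m P : mcoeff m (complexify P) = ((mcoeff m P)%:C)%C.
Proof. exact: mcoeff_map_mpoly. Qed.

Lemma complexify_inj : injective (@complexify R d).
Proof.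
move=> P Q PQ; apply/mpolyP => m; apply: complexI.
by rewrite -!mcoeff_complexify PQ.
Qed.

Lemma deriv_complexify i P : mderiv i (complexify P) = complexify (mderiv i P).
Proof.
apply/mpolyP => m; rewrite mcoeff_deriv !mcoeff_complexify mcoeff_deriv.
by rewrite -[RHS]/(real_complex R _) rmorphMn.
Qed.

Lemma lap_complexify P : lap (complexify P) = complexify (lap P).
Proof.
rewrite /lap [RHS]raddf_sum; apply: eq_bigr => i _.
by rewrite !deriv_complexify.
Qed.

Lemma dhomog_complexify k P :
  (complexify P \is ishomog1 k (@mdeg d)) = (P \is ishomog1 k (@mdeg d)).
Proof.
have E m : (m \in msupp (complexify P)) = (m \in msupp P).
  by rewrite !mcoeff_msupp mcoeff_complexify (fmorph_eq0 (real_complex R)).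
by apply/dhomogP/dhomogP => h m mP; apply: h; rewrite ?E// -E.
Qed.

Lemma harmonic_complexify k P : harmonic_homog k (complexify P) ->
  P \is ishomog1 k (@mdeg d) /\ lap P = 0.
Proof.
move=> [hP lP]; split; first by rewrite -dhomog_complexify.
apply: complexify_inj; rewrite -lap_complexify /complexify raddf0; exact: lP.
Qed.

Lemma ceval_complexify P x : ceval (complexify P) x = ((reval P x)%:C)%C.
Proof.
elim/mpolyind: P => [|c m P _ _ IH].
  by rewrite /complexify raddf0 /ceval /reval !meval0.
rewrite /complexify raddfD/= map_mpolyZ map_mpolyX -/(complexify P).
move: IH; rewrite /ceval /reval !mevalD !mevalZ !mevalX => ->.
rewrite -!/(real_complex R _) rmorphD rmorphM rmorph_prod/=; congr (_ * _ + _).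
by apply: eq_bigr => i _; rewrite rmorphXn.
Qed.

End complexification.

(** * Orthogonality on the sphere in terms of positive parts *)

Section sphere_pairing.
Context {R : realType} {d : nat} (a : nat -> nat).
Variables (Y : forall k, 'I_(a k) -> mpoly d R) (Yb : harmonic_basis Y).
Local Open Scope ereal_scope.

(* The integral over the sphere of the positive part of e W. *)
Definition sphere_part (e : R) (W : mpoly d R) : \bar R :=
  (d%:R)%:E * \int[lebesgue_tuple d]_(x in punctured_ball)
    (Num.max (e * reval W (radial_proj x)) 0)%:E.

Lemma measurable_pospart e W : measurable_fun [set: Rvec R d]
  (fun x => (Num.max (e * reval W (radial_proj x)) 0)%:E).
Proof.
apply/measurable_EFinP; apply: measurable_maxr => //; apply: measurable_funM => //.
exact: (measurableT_comp (measurable_reval W) measurable_radial_proj).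
Qed.

Lemma punctured_ball_finite : lebesgue_tuple d (punctured_ball : set (Rvec R d)) < +oo.
Proof.
apply: le_lt_trans (sqball_finite 1%R); apply: le_measure; rewrite ?inE.
- exact: measurable_punctured_ball.
- exact: measurable_sqball.
by move=> x /andP[_ x1]; rewrite /sqball/= -sqr_enorm expr_le1 ?enorm_ge0.
Qed.

Lemma sphere_part_fin e W : sphere_part e W \is a fin_num.
Proof.
rewrite /sphere_part fin_numM// ge0_fin_numE; last first.
  by apply: integral_ge0 => x _; rewrite lee_fin le_max lexx orbT.
have [M WM] := reval_bounded 1%R W.
apply: (@le_lt_trans _ _ (\int[lebesgue_tuple d]_(x in punctured_ball) (`|e| * M)%:E)).
  apply: ge0_le_integral => //.
  - exact: measurable_punctured_ball.
  - by move=> x _; rewrite lee_fin le_max lexx orbT.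
  - by apply: measurable_funTS; exact: measurable_pospart.
  - move=> x /andP[x0 _]; rewrite lee_fin.
    apply: (@le_trans _ _ `|e * reval W (radial_proj x)|%R).
      by rewrite ge_max ler_norm normr_ge0.
    rewrite normrM ler_wpM2l// WM// /sqball/= -sqr_enorm.
    by rewrite enorm_radial_proj// expr1n.
rewrite integral_cst; last exact: measurable_punctured_ball.
rewrite lte_mul_pinfty// ?lee_fin; last exact: punctured_ball_finite.
rewrite mulr_ge0//; apply: le_trans (WM [tuple 0%R | i < d] _) => //.
rewrite /sqball/= sqnormE big1 ?ler01// => i _; by rewrite tnth_mktuple expr0n.
Qed.

(** Distinct degrees give the product positive degree k + k', and orthogonality on balls is the
    other hypothesis of [sphere_posneg]. *)
Lemma sphere_part_neq k k' (l : 'I_(a k)) (l' : 'I_(a k')) : k != k' ->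
  sphere_part 1 (Y l * Y l')%R = sphere_part (-1) (Y l * Y l')%R.
Proof.
move=> kk'; congr (_ * _).
have [hP lP] := harmonic_complexify (basis_in Yb l).
have [hQ lQ] := harmonic_complexify (basis_in Yb l').
under eq_integral do rewrite mul1r; under [RHS]eq_integral do rewrite mulN1r.
apply: (@sphere_posneg _ _ (k + k')).
- by case: k k' kk' {l l' hP hQ lP lQ} => [|k] [|k'].
- exact: dhomogM.
- by move=> s; exact: (harmonic_orthogonal_sqball _ kk').
Qed.

(** The real integral in [basis_orthonormal] is the [fine] of a difference of two parts; both are
    finite, so it can be rewritten as a sum in [\bar R]. *)
Lemma sphere_part_eq k (l l' : 'I_(a k)) :
  sphere_part 1 (Y l * Y l')%R = sphere_part (-1) (Y l * Y l')%R + ((l == l')%:R)%:E.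
Proof.
have := basis_orthonormal Yb l l'; rewrite /Rintegral integralE.
pose W : mpoly d R := (Y l * Y l')%R.
have mW : measurable_fun [set: Rvec R d] (fun x => (reval W x)%:E).
  by apply/measurable_EFinP; exact: measurable_reval.
have WE : (fun x => (reval (Y l) x * reval (Y l') x)%:E) = (fun x => (reval W x)%:E).
  by apply/funext => x; rewrite /reval mevalM.
rewrite WE !ge0_integral_surface//; [|exact: measurable_funeneg|exact: measurable_funepos].
have -> : \int[lebesgue_tuple d]_(x in punctured_ball)
    ((fun x => (reval W x)%:E)^\+ (radial_proj x)) =
  \int[lebesgue_tuple d]_(x in punctured_ball)
    (Num.max (1 * reval W (radial_proj x)) 0)%:E.
  by apply: eq_integral => x _; rewrite funeposE mul1r EFin_max.
have -> : \int[lebesgue_tuple d]_(x in punctured_ball)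
    ((fun x => (reval W x)%:E)^\- (radial_proj x)) =
  \int[lebesgue_tuple d]_(x in punctured_ball)
    (Num.max (-1 * reval W (radial_proj x)) 0)%:E.
  by apply: eq_integral => x _; rewrite funenegE mulN1r EFin_max EFinN.
rewrite -/(sphere_part 1 W) -/(sphere_part (-1) W).
rewrite -(fineK (sphere_part_fin 1 W)) -(fineK (sphere_part_fin (-1) W)).
by rewrite -EFinB/= => <-; rewrite -EFinD addrC subrK.
Qed.

End sphere_pairing.

(** * Construction of nu_+ and nu_- *)

Section pseudo_positive_measures.
Context {R : realType} {d : nat} (a : nat -> nat).
Variables (Y : forall k, 'I_(a k) -> mpoly d R) (Yb : harmonic_basis Y).
Variable s : forall k, 'I_(a k) -> {finite_measure set (measurableTypeR R) -> \bar R}.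
Local Open Scope ereal_scope.

Lemma nneseries_single (u : nat -> \bar R) n : 0 <= u n ->
  (forall k, k != n -> u k = 0) -> \sum_(0 <= k <oo) u k = u n.
Proof.
move=> un u0; rewrite (eq_eseriesr (g := fun k => if k == n then u k else 0)).
  rewrite -(eseries_mkcond (P := pred1 n)) nneseries_esum => [|k /eqP ->//].
  rewrite (_ : [set x | _] = [set n]) ?esum_set1//.
  by apply/seteqP; split=> k /= /eqP.
by move=> k _; case: eqVneq => // /u0.
Qed.

Lemma integral_tensor (m : {finite_measure set (measurableTypeR R) -> \bar R})
    (u : measurableTypeR R -> R) (v : Rvec R d -> R) :
  measurable_fun [set: measurableTypeR R] u -> (forall r, 0 <= u r)%R ->
  measurable_fun [set: Rvec R d] v -> (forall x, 0 <= v x)%R ->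
  \int[m \x lebesgue_tuple d]_z (u z.1 * v z.2)%:E =
  \int[m]_r (u r)%:E * \int[lebesgue_tuple d]_x (v x)%:E.
Proof.
move=> mu u0 mv v0.
rewrite (fubini_tonelli1 (fun z : measurableTypeR R * Rvec R d => (u z.1 * v z.2)%:E)); last 2 first.
- apply/measurable_EFinP; apply: measurable_funM; exact: measurableT_comp.
- by move=> z; rewrite lee_fin mulr_ge0.
rewrite -ge0_integralZr//; last 3 first.
- exact/measurable_EFinP.
- by move=> r _; rewrite lee_fin.
- by apply: integral_ge0 => x _; rewrite lee_fin.
apply: eq_integral => r _; rewrite -ge0_integralZl//.
- exact/measurable_EFinP.
- by move=> x _; rewrite lee_fin.
- by rewrite lee_fin.
Qed.

(** The radial variable ranges over all of R, hence the absolute value; the measures [s] used in the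
    end are carried by [0, +oo[. *)
Definition polar (z : measurableTypeR R * Rvec R d) : Rvec R d :=
  dilate `|z.1 : R|%R (radial_proj z.2).

(** For [e] = 1 or -1, the Lebesgue density whose image under [radial_proj] is Y_kl^+ or Y_kl^-
    times the surface measure. *)
Definition angular_weight e k (l : 'I_(a k)) (x : Rvec R d) : R :=
  (d%:R * Num.max (e * reval (Y l) (radial_proj x)) 0 * \1_(punctured_ball) x)%R.

(* At r = 0 and k > 0, r ^- k is 0 here; this is harmless, since sigma_kl {0} = 0
   for k > 0 by summability (sigma_set1_eq0). *)
Definition weight e k (l : 'I_(a k)) (z : measurableTypeR R * Rvec R d) : R :=
  (`|z.1 : R| ^- k * angular_weight e l z.2)%R.

Lemma measurable_polar : measurable_fun [set: measurableTypeR R * Rvec R d] polar.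
Proof.
apply/measurable_fun_tnthP => i.
rewrite (_ : _ \o _ = fun z => `|z.1 : R|%R * (tnth (radial_proj z.2) i : R))%R; last first.
  by apply/funext => z /=; rewrite tnth_mktuple.
apply: (@measurable_funM _ _ _ _ (fun z : measurableTypeR R * Rvec R d => `|z.1 : R|%R)).
  by apply: measurableT_comp => //; exact: measurable_fst.
have := (measurable_fun_tnthP (@radial_proj R d)).1 measurable_radial_proj i => h.
exact: (measurableT_comp h measurable_snd).
Qed.

Lemma measurable_norm_expV k :
  measurable_fun [set: measurableTypeR R] (fun r => `|r : R| ^- k)%R.
Proof.
rewrite (_ : (fun r => _) = fun r => `|r : R| `^ (- k%:R))%R; last first.
  by apply/funext => t; rewrite powRN powR_mulrn.
apply: (@measurableT_comp _ _ _ _ _ _ (@powR R ^~ (- k%:R)%R)).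
  exact: measurable_powR.
exact: normr_measurable.
Qed.

Lemma measurable_angular_weight e k (l : 'I_(a k)) :
  measurable_fun [set: Rvec R d] (angular_weight e l).
Proof.
apply: measurable_funM; last first.
  by apply: measurable_indic; exact: measurable_punctured_ball.
apply: measurable_funM => //; apply/measurable_EFinP; exact: measurable_pospart.
Qed.

Lemma angular_weight_ge0 e k (l : 'I_(a k)) x : (0 <= angular_weight e l x)%R.
Proof. by rewrite !mulr_ge0// le_max lexx orbT. Qed.

Lemma measurable_weight e k (l : 'I_(a k)) :
  measurable_fun [set: measurableTypeR R * Rvec R d] (weight e l).
Proof.
apply: measurable_funM.
  exact: (measurableT_comp (measurable_norm_expV k) measurable_fst).
exact: (measurableT_comp (measurable_angular_weight e l) measurable_snd).
Qed.

Lemma weight_ge0 e k (l : 'I_(a k)) z : (0 <= weight e l z)%R.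
Proof. by rewrite mulr_ge0 ?angular_weight_ge0// invr_ge0 exprn_ge0. Qed.

(** The share of the pair (k, l) in the integral of [f] against nu_+ ([e] = 1) or nu_- ([e] =
    -1). *)
Definition part_integral e k (l : 'I_(a k)) (f : Rvec R d -> \bar R) :=
  \int[s l \x lebesgue_tuple d]_z (f (polar z) * (weight e l z)%:E).

Lemma pseudo_measure_exists e : exists nu : {measure set (Rvec R d) -> \bar R},
  forall f : Rvec R d -> \bar R, measurable_fun [set: Rvec R d] f ->
    (forall x, 0 <= f x) ->
  \int[nu]_x f x = \sum_(0 <= k <oo) \sum_(l < a k) part_integral e l f.
Proof.
have nu_l k (l : 'I_(a k)) : {nu : {measure set (Rvec R d) -> \bar R} | forall f,
    measurable_fun [set: Rvec R d] f -> (forall x, 0 <= f x) ->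
    \int[nu]_x f x = part_integral e l f}.
  (* [weighted_image] expects the product packed as a sigma-finite measure. *)
  pose sf := Measure_isSigmaFinite.Build _ _ _ (s l \x lebesgue_tuple d)
    (sigma_finite_product (s l) (lebesgue_tuple d)).
  pose m : {sigma_finite_measure set (measurableTypeR R * Rvec R d)%type -> \bar R} :=
    HB.pack (s l \x lebesgue_tuple d) sf.
  exact/cid/(weighted_image m measurable_polar (measurable_weight e l) (weight_ge0 e l)).
have nu_k k := cid (integral_sum_measure (fun l : 'I_(a k) => sval (nu_l k l))).
exists (mseries (fun k => sval (nu_k k)) 0) => f mf f0.
rewrite ge0_integral_measure_series//; apply: eq_eseriesr => k _.
rewrite (svalP (nu_k k))//; apply: eq_bigr => l _.
exact: (svalP (nu_l k l) f).
Qed.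

End pseudo_positive_measures.

(** * Pairing nu_+ and nu_- with h(|x|) Y_kl *)

Section pairing.
Context {R : realType} {d : nat} (a : nat -> nat).
Variables (Y : forall k, 'I_(a k) -> mpoly d R) (Yb : harmonic_basis Y).
Variable s : forall k, 'I_(a k) -> {finite_measure set (measurableTypeR R) -> \bar R}.
Local Open Scope ereal_scope.

Lemma part_integral_ge0 e k (l : 'I_(a k)) f : (forall x, 0 <= f x) ->
  0 <= part_integral Y s e l f.
Proof.
move=> f0; apply: integral_ge0 => z _; apply: mule_ge0 => //.
by rewrite lee_fin weight_ge0.
Qed.

(** Tonelli for a function that separates in polar coordinates. Separation on the unit sphere is
    enough because the weight vanishes off the punctured ball. *)
Lemma part_integral_polar e k (l : 'I_(a k)) f (u : measurableTypeR R -> R)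
    (v : Rvec R d -> R) :
  measurable_fun [set: measurableTypeR R] u -> (forall r, 0 <= r -> 0 <= u r)%R ->
  measurable_fun [set: Rvec R d] v -> (forall x, 0 <= v x)%R ->
  (forall r x, (0 <= r)%R -> enorm x = 1%R -> f (dilate r x) = (u r * v x)%:E) ->
  part_integral Y s e l f = \int[s l]_r (u `|r : R|%R * `|r : R| ^- k)%:E *
    ((d%:R)%:E * \int[lebesgue_tuple d]_(x in punctured_ball)
      (v (radial_proj x) * Num.max (e * reval (Y l) (radial_proj x)) 0)%:E).
Proof.
move=> mu u0 mv v0 fE.
have mvp : measurable_fun [set: Rvec R d] (fun x => v (radial_proj x)).
  exact: (measurableT_comp mv measurable_radial_proj).
have mun : measurable_fun [set: measurableTypeR R] (fun r => u `|r : R|%R).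
  by apply: (measurableT_comp mu); exact: normr_measurable.
transitivity (\int[s l \x lebesgue_tuple d]_z ((u `|z.1 : R| * `|z.1 : R| ^- k) *
    (v (radial_proj z.2) * angular_weight Y e l z.2))%:E).
  apply: eq_integral => -[r x] _; rewrite /polar /weight /=.
  have [/set_mem/andP[x0 _]|xB] := boolP (x \in punctured_ball).
    rewrite fE// ?enorm_radial_proj// -EFinM; congr EFin; ring.
  rewrite /angular_weight indicE (negbTE xB).
  by rewrite !(mulr0, mule0).
rewrite (@integral_tensor _ _ (s l) (fun r => u `|r : R| * `|r : R| ^- k)%R
  (fun x => v (radial_proj x) * angular_weight Y e l x)%R); last 4 first.
- by apply: measurable_funM => //; exact: measurable_norm_expV.
- by move=> r; rewrite mulr_ge0 ?u0// invr_ge0 exprn_ge0.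
- by apply: measurable_funM => //; exact: measurable_angular_weight.
- by move=> x; rewrite mulr_ge0// angular_weight_ge0.
congr (_ * _); rewrite -ge0_integralZl//; last 3 first.
- exact: measurable_punctured_ball.
- apply/measurable_EFinP; apply: measurable_funTS; apply: measurable_funM => //.
  by apply/measurable_EFinP; exact: measurable_pospart.
- by move=> x _; rewrite lee_fin mulr_ge0// le_max lexx orbT.
rewrite [RHS]integral_mkcond; apply: eq_integral => x _.
rewrite patchE /angular_weight indicE; case: ifP => _; rewrite ?mulr0//.
by rewrite mulr1 -EFinM mulrCA.
Qed.

(** The integral over the sphere of (e P)^+ (e' Q)^+. *)
Definition mixed_part e e' (P Q : mpoly d R) : \bar R :=
  (d%:R)%:E * \int[lebesgue_tuple d]_(x in punctured_ball)
    (Num.max (e' * reval Q (radial_proj x)) 0 *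
     Num.max (e * reval P (radial_proj x)) 0)%:E.

Lemma mixed_part_ge0 e e' P Q : 0 <= mixed_part e e' P Q.
Proof.
apply: mule_ge0; first by rewrite lee_fin.
by apply: integral_ge0 => x _; rewrite lee_fin mulr_ge0// le_max lexx orbT.
Qed.

(* Applied to (yz)^+ = y^+ z^+ + y^- z^- and (yz)^- = y^+ z^- + y^- z^+
   without subtracting possibly infinite integrals. *)
Lemma mixed_partD e1 e2 e1' e2' e P Q :
  (forall y z : R, Num.max (e * (y * z)) 0 =
    Num.max (e1' * z) 0 * Num.max (e1 * y) 0 + Num.max (e2' * z) 0 * Num.max (e2 * y) 0)%R ->
  mixed_part e1 e1' P Q + mixed_part e2 e2' P Q = sphere_part e (P * Q)%R.
Proof.
move=> E; rewrite /mixed_part -ge0_muleDr; last 2 first.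
- by apply: integral_ge0 => x _; rewrite lee_fin mulr_ge0// le_max lexx orbT.
- by apply: integral_ge0 => x _; rewrite lee_fin mulr_ge0// le_max lexx orbT.
have mm e0 e0' : measurable_fun punctured_ball (fun x =>
    (Num.max (e0' * reval Q (radial_proj x)) 0 *
     Num.max (e0 * reval P (radial_proj x)) 0)%:E).
  apply/measurable_EFinP; apply: measurable_funTS; apply: measurable_funM;
  by apply/measurable_EFinP; exact: measurable_pospart.
rewrite -ge0_integralD//; last 3 first.
- exact: measurable_punctured_ball.
- by move=> x _; rewrite lee_fin mulr_ge0// le_max lexx orbT.
- by move=> x _; rewrite lee_fin mulr_ge0// le_max lexx orbT.
congr (_ * _); apply: eq_integral => x _.
by rewrite -EFinD -E /reval mevalM.
Qed.

(** Both cases of orthogonality at once; [Tagged] allows comparing [l] and [l'], whose types depend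
    on the degrees. *)
Lemma sphere_part_basis k k' (l : 'I_(a k)) (l' : 'I_(a k')) :
  sphere_part 1 (Y l * Y l')%R = sphere_part (-1) (Y l * Y l')%R +
    ((Tagged (fun k => 'I_(a k)) l == Tagged (fun k => 'I_(a k)) l')%:R)%:E.
Proof.
have [kk'|kk'] := eqVneq k k'.
  by subst k'; rewrite (sphere_part_eq Yb) eq_Tagged.
rewrite (sphere_part_neq Yb)// (_ : (_ == _) = false) ?adde0//.
by apply/negP => /eqP/(congr1 tag)/= /eqP; rewrite (negbTE kk').
Qed.

Definition represents e (nu : {measure set (Rvec R d) -> \bar R}) :=
  forall f, measurable_fun [set: Rvec R d] f -> (forall x, 0 <= f x) ->
  \int[nu]_x f x = \sum_(0 <= k <oo) \sum_(l < a k) part_integral Y s e l f.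

Section radial_times_harmonic.
Variables (h : measurableTypeR R -> R) (mh : measurable_fun [set: measurableTypeR R] h).
Hypothesis h0 : forall r, (0 <= h r)%R.
Variables (k' : nat) (l' : 'I_(a k')).
Let F (x : Rvec R d) : R := (h (enorm x) * reval (Y l') x)%R.
Let Fpart e x : \bar R := (Num.max (e * F x) 0)%:E.
(** The radial factor; for k = k' the two powers cancel away from 0. *)
Let I k (l : 'I_(a k)) : \bar R :=
  \int[s l]_r (h `|r : R|%R * `|r : R| ^+ k' * `|r : R| ^- k)%:E.

Let I_ge0 k (l : 'I_(a k)) : 0 <= I l.
Proof.
by apply: integral_ge0 => r _; rewrite lee_fin !mulr_ge0 ?exprn_ge0// invr_ge0 exprn_ge0.
Qed.

Let mF : measurable_fun [set: Rvec R d] F.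
Proof.
apply: measurable_funM; last exact: measurable_reval.
exact: (measurableT_comp mh measurable_enorm).
Qed.

Let mFpart e : measurable_fun [set: Rvec R d] (Fpart e).
Proof.
apply/measurable_EFinP; apply: measurable_maxr => //.
exact: measurable_funM.
Qed.

Let Fpart_ge0 e x : 0 <= Fpart e x.
Proof. by rewrite lee_fin le_max lexx orbT. Qed.

Lemma part_integral_Fpart e e' k (l : 'I_(a k)) :
  part_integral Y s e l (Fpart e') = I l * mixed_part e e' (Y l) (Y l').
Proof.
have [hY _] := harmonic_complexify (basis_in Yb l').
apply: (@part_integral_polar e k l (Fpart e') (fun r : measurableTypeR R => h r * r ^+ k')%R
    (fun x => Num.max (e' * reval (Y l') x) 0)%R).
- apply: measurable_funM => //; apply: measurable_funX; exact: measurable_id.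
- by move=> r r0; rewrite mulr_ge0 ?exprn_ge0.
- apply: measurable_maxr => //; apply: measurable_funM => //; exact: measurable_reval.
- by move=> x; rewrite le_max lexx orbT.
move=> r x r0 x1; rewrite /Fpart /F enorm_dilate x1 mulr1 ger0_norm//.
rewrite (reval_dilate _ _ hY); congr EFin.
rewrite maxr_pMr ?mulr_ge0 ?exprn_ge0// mulr0; congr (Num.max _ _); ring.
Qed.

(* The pairing of h(|x|) Y_kl with nu1 - nu2, with all terms moved to the side
   where they are nonnegative, so that no subtraction in \bar R occurs. *)
Lemma represents_pairing nu1 nu2 : represents 1 nu1 -> represents (-1) nu2 ->
  \int[nu1]_x Fpart 1 x + \int[nu2]_x Fpart (-1) x =
  \int[nu1]_x Fpart (-1) x + \int[nu2]_x Fpart 1 x + I l'.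
Proof.
move=> nu1E nu2E; rewrite !(nu1E, nu2E)//.
have pos e k (l : 'I_(a k)) e' : 0 <= part_integral Y s e l (Fpart e').
  exact: part_integral_ge0.
have spos e k e' : 0 <= \sum_(l < a k) part_integral Y s e l (Fpart e').
  by apply: sume_ge0 => l _; exact: pos.
pose tag_eq k (l : 'I_(a k)) : bool :=
  Tagged (fun k => 'I_(a k)) l == Tagged (fun k => 'I_(a k)) l'.
(* Writing [I l'] as a series with a single nonzero term lets the identity be proved term by
   term. *)
have delta : \sum_(0 <= k <oo) \sum_(l < a k) (I l * ((tag_eq k l)%:R)%:E) = I l'.
  rewrite (@nneseries_single _ _ k').
  - rewrite (bigD1 l')//= /tag_eq eqxx mule1 big1 ?adde0// => l ll'.
    by rewrite eq_Tagged/= (negbTE ll') mule0.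
  - by apply: sume_ge0 => l _; rewrite mule_ge0// lee_fin.
  - move=> k kk'; rewrite big1// => l _; rewrite /tag_eq (_ : (_ == _) = false) ?mule0//.
    by apply/negP => /eqP/(congr1 tag)/= /eqP; rewrite (negbTE kk').
rewrite -[in RHS]delta -!nneseriesD//; last 2 first.
- by move=> k _ _; apply: adde_ge0.
- by move=> k _ _; apply: sume_ge0 => l _; rewrite mule_ge0// lee_fin.
apply: eq_eseriesr => k _; rewrite -!big_split/=; apply: eq_bigr => l _.
have mulD x y : 0 <= x -> 0 <= y -> I l * x + I l * y = I l * (x + y).
  by move=> x0 y0; rewrite ge0_muleDr.
rewrite !part_integral_Fpart !mulD ?mixed_part_ge0 ?adde_ge0 ?mixed_part_ge0 ?lee_fin//.
(* In this form the sign identities for (yz)^+ and (yz)^- are polynomial in y, z, |y|, |z|. *)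
have maxE (t : R) : Num.max t 0%R = ((t + `|t|) / 2)%R by rewrite maxr_absE subr0 addr0.
rewrite (@mixed_partD 1 (-1) 1 (-1) 1); last first.
  by move=> y z; rewrite !maxE !(normrM, normrN, normr1); field.
rewrite (@mixed_partD 1 (-1) (-1) 1 (-1)); last first.
  by move=> y z; rewrite !maxE !(normrM, normrN, normr1); field.
by rewrite (sphere_part_basis l l').
Qed.

End radial_times_harmonic.

End pairing.

(** * Finite moments, and the pairing as a difference of integrals *)

Section moments.
Context {R : realType} {d : nat} (a : nat -> nat).
Variables (Y : forall k, 'I_(a k) -> mpoly d R) (Yb : harmonic_basis Y).
Variable s : forall k, 'I_(a k) -> {finite_measure set (measurableTypeR R) -> \bar R}.
Variable sigma : forall k, 'I_(a k) -> {measure set (measurableTypeR R) -> \bar R}.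
Local Open Scope ereal_scope.
Hypothesis sE : forall k (l : 'I_(a k)) (f : measurableTypeR R -> \bar R),
  measurable_fun [set: measurableTypeR R] f -> (forall r, 0 <= f r) ->
  \int[s l]_r f r = \int[sigma l]_(r in [set r : R | (0 <= r)%R]) f r.
Hypothesis summable : forall N : nat,
  \sum_(0 <= k <oo) \sum_(l < a k)
    \int[sigma l]_(r in [set r : R | (0 <= r)%R]) rpow_sub N k r < +oo.

Lemma measurable_halfline : measurable [set r : measurableTypeR R | (0 <= r)%R].
Proof.
rewrite (_ : [set _ | _] = `[0%R, +oo[%classic)//.
by apply/seteqP; split=> r /=; rewrite in_itv/= andbT.
Qed.

Lemma rpow_sub_ge0 N k (r : R) : (0 <= r)%R -> 0 <= rpow_sub N k r.
Proof.
move=> r0; rewrite /rpow_sub; case: ifP => _; first by rewrite lee_fin exprn_ge0.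
by case: ifP => _; rewrite ?leey// lee_fin invr_ge0 exprn_ge0.
Qed.

Lemma measurable_rpow_sub N k :
  measurable_fun [set r : measurableTypeR R | (0 <= r)%R] (rpow_sub N k).
Proof.
have [kN|Nk] := leqP k N.
  rewrite (_ : rpow_sub N k = fun r => (r ^+ (N - k))%:E); last first.
    by apply/funext => r; rewrite /rpow_sub kN.
  by apply/measurable_EFinP; apply: measurable_funX; exact: measurable_id.
apply: (@eq_measurable_fun _ _ _ _ _
    (fun r : R => if r == 0%R then +oo else (`|r| ^- (k - N))%:E)).
  move=> r /set_mem r0; rewrite /rpow_sub leqNgt Nk/=.
  by rewrite ger0_norm.
apply: measurable_funTS; apply: measurable_fun_if => //.
  apply: (measurable_fun_bool true).
  rewrite setTI (_ : _ @^-1` _ = [set 0%R]); first exact: measurable_set1.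
  by apply/seteqP; split=> r /= /eqP.
apply: measurable_funTS; apply/measurable_EFinP; exact: measurable_norm_expV.
Qed.

(** A bound independent of [k] and [l], so that it factors out of the double series. The term 1 is
    the integral of Y_kl^2, a square having no negative part. *)
Lemma angular_mass_le e k (l : 'I_(a k)) : (`|e| <= 1)%R ->
  (d%:R)%:E * \int[lebesgue_tuple d]_(x in punctured_ball)
    (1 * Num.max (e * reval (Y l) (radial_proj x)) 0)%:E <=
  (d%:R)%:E * lebesgue_tuple d punctured_ball + 1.
Proof.
move=> e1.
have <- : sphere_part 1 (Y l * Y l)%R = 1.
  rewrite (sphere_part_eq Yb) eqxx /sphere_part integral0_eq ?mule0 ?add0e// => x _.
  rewrite /reval mevalM; congr EFin; apply/max_idPr.
  by rewrite mulN1r oppr_le0 -expr2 sqr_ge0.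
have mB := @measurable_punctured_ball R d.
rewrite -[in leRHS](mul1e (lebesgue_tuple d _)) -integral_cst//.
rewrite -ge0_muleDr; last 2 first.
- by apply: integral_ge0.
- by apply: integral_ge0 => x _; rewrite lee_fin le_max lexx orbT.
rewrite lee_wpmul2l ?lee_fin// -ge0_integralD//; last 2 first.
- by move=> x _; rewrite lee_fin le_max lexx orbT.
- by apply: measurable_funTS; exact: measurable_pospart.
have mP := measurable_funTS (measurable_pospart e (Y l)).
apply: ge0_le_integral => //.
- by move=> x _; rewrite lee_fin mul1r le_max lexx orbT.
- by under eq_fun do rewrite mul1r; exact: mP.
- by apply: emeasurable_funD => //; apply: measurable_funTS; exact: measurable_pospart.
move=> x _; rewrite -EFinD lee_fin !mul1r /reval mevalM -/(reval _ _).
move: (reval (Y l) _) => y; rewrite ge_max; apply/andP; split; last first.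
  by rewrite addr_ge0// le_max lexx orbT.
apply: (@le_trans _ _ (1 + y * y)%R); last by rewrite lerD2l le_max lexx.
move: e1; rewrite ler_norml => /andP[e1 e2].
(* This gives e y <= y^2 + e^2 / 4, and e^2 <= 1. *)
have := sqr_ge0 (y - e / 2)%R.
have : (0 <= (1 - e) * (1 + e))%R by apply: mulr_ge0; lra.
by lra.
Qed.

(** Each term is an angular mass, at most [C], times the integral of r^N r^-k; the sum is at most
    [C] times the series in [summable]. *)
Lemma moment_finite e nu N : (`|e| <= 1)%R -> represents Y s e nu ->
  \int[nu]_x (enorm x ^+ N)%:E < +oo.
Proof.
move=> e1 nuE; rewrite nuE; last 2 first.
- by apply/measurable_EFinP; apply: measurable_funX; exact: measurable_enorm.
- by move=> x; rewrite lee_fin exprn_ge0// enorm_ge0.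
pose C := (d%:R)%:E * lebesgue_tuple d (punctured_ball : set (Rvec R d)) + 1.
have Cfin : C \is a fin_num.
  rewrite fin_numD andbT fin_numM// ge0_fin_numE//; exact: punctured_ball_finite.
have C0 : 0 <= C by rewrite adde_ge0// mule_ge0// lee_fin.
have a0 k (l : 'I_(a k)) :
    0 <= \int[sigma l]_(r in [set r : R | (0 <= r)%R]) rpow_sub N k r.
  by apply: integral_ge0 => r r0; exact: rpow_sub_ge0.
apply: (@le_lt_trans _ _ (C * \sum_(0 <= k <oo) \sum_(l < a k)
    \int[sigma l]_(r in [set r : R | (0 <= r)%R]) rpow_sub N k r)); last first.
  by rewrite lte_mul_pinfty// summable.
rewrite -(fineK Cfin) -nneseriesZl; last first.
  by move=> k _; apply: sume_ge0 => l _.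
apply: lee_nneseries => [k _ _|k _].
  apply: sume_ge0 => l _; apply: part_integral_ge0 => x.
  by rewrite lee_fin exprn_ge0// enorm_ge0.
rewrite fineK// ge0_sume_distrr//; apply: lee_sum => l _.
rewrite (@part_integral_polar _ _ _ Y s e k l _ (fun r : measurableTypeR R => r ^+ N)%R (fun=> 1%R)); last 5 first.
- by apply: measurable_funX; exact: measurable_id.
- by move=> r r0; rewrite exprn_ge0.
- by [].
- by [].
- by move=> r x r0 x1; rewrite enorm_dilate x1 mulr1 mulr1 ger0_norm.
rewrite muleC; apply: lee_pmul.
- apply: mule_ge0; rewrite ?lee_fin//; apply: integral_ge0 => x _.
  by rewrite lee_fin mul1r le_max lexx orbT.
- by apply: integral_ge0 => r _; rewrite lee_fin mulr_ge0 ?exprn_ge0// invr_ge0 exprn_ge0.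
- exact: angular_mass_le.
have mrN : measurable_fun [set: measurableTypeR R]
    (fun r => (`|r : R| ^+ N * `|r : R| ^- k)%:E).
  apply/measurable_EFinP; apply: measurable_funM; last exact: measurable_norm_expV.
  by apply: measurable_funX; exact: normr_measurable.
rewrite sE//.
apply: ge0_le_integral => //.
- exact: measurable_halfline.
- exact: measurable_funTS.
- exact: measurable_rpow_sub.
move=> r r0; rewrite ger0_norm// /rpow_sub.
(* At 0 only an inequality holds: for k > 0 the left side is 0 because 1 / 0 = 0, while [rpow_sub]
   may be 1 or +oo. Elsewhere both sides agree. *)
have [->|rn0] := eqVneq r 0%R.
  case: leqP => kN; last exact: leey.
  case: k {l a0 mrN} kN => [|k] kN; first by rewrite expr0 invr1 mulr1 subn0.
  by rewrite expr0n/= (gtn_eqF (leq_trans _ kN))// mul0r lee_fin exprn_ge0.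
case: leqP => kN; rewrite lee_fin le_eqVlt; apply/orP; left; apply/eqP.
  by rewrite -{1}(subnK kN) exprD mulfK// expf_neq0.
by rewrite -{1}(subnK (ltnW kN)) exprD invfM mulrCA mulfV ?mulr1// expf_neq0.
Qed.

(* rpow_sub 0 k is +oo at 0 when k > 0. *)
Lemma sigma_set1_eq0 k (l : 'I_(a k)) : (0 < k)%N -> sigma l [set 0%R] = 0.
Proof.
move=> k0; pose u k := \sum_(l < a k)
  \int[sigma l]_(r in [set r : R | (0 <= r)%R]) rpow_sub 0 k r.
have a0 j (i : 'I_(a j)) :
    0 <= \int[sigma i]_(r in [set r : R | (0 <= r)%R]) rpow_sub 0 j r.
  by apply: integral_ge0 => r r0; exact: rpow_sub_ge0.
have u0 j : 0 <= u j by apply: sume_ge0 => i _.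
have : \int[sigma l]_(r in [set 0%R]) rpow_sub 0 k r < +oo.
  apply: le_lt_trans (summable 0).
  apply: (@le_trans _ _ (u k)); last first.
    apply: le_trans (nneseries_lim_ge k.+1 (fun n _ _ => u0 n)).
    by rewrite big_nat_recr//= leeDr// sume_ge0.
  rewrite /u (bigD1 l)//=; apply: (@le_trans _ _
      (\int[sigma l]_(r in [set r : R | (0 <= r)%R]) rpow_sub 0 k r)); last first.
    by rewrite leeDl// sume_ge0.
  apply: ge0_subset_integral => //; first exact: measurable_halfline.
  - exact: measurable_rpow_sub.
  - by move=> r r0; exact: rpow_sub_ge0.
  - by move=> r /= ->.
rewrite (eq_integral (cst +oo)); last first.
  by move=> r /set_mem ->; rewrite /rpow_sub leqNgt k0/= eqxx.
rewrite integral_cst//= => fin; apply/eqP; rewrite -measure_le0.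
rewrite leNgt; apply/negP => s0; move: fin.
by rewrite gt0_mulye.
Qed.

(** Homogeneity carries a bound on the unit ball to all [x]; the origin is treated apart, with 0^0 =
    1 for constants. *)
Lemma harmonic_growth k (P : mpoly d R) : P \is ishomog1 k (@mdeg d) ->
  exists2 M : R, (0 <= M)%R & forall x, (`|reval P x| <= M * enorm x ^+ k)%R.
Proof.
move=> Pk; have [M PM] := reval_bounded 1%R P.
have M0 : (0 <= M)%R.
  apply: le_trans (PM (dilate 0 [tuple 0%R | i < d]) _) => //.
  by rewrite /sqball/= (reval_dilate _ _ (@dhomog_sqnorm R d)) expr0n mul0r ler01.
exists M => // x; have [x0|x0] := eqVneq (enorm x) 0%R.
  have -> : reval P x = (0 ^+ k * reval P x)%R.
    case: k Pk => [|k] Pk; first by rewrite mul1r.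
    by rewrite (dhomog_reval0 _ Pk x0)// mulr0.
  rewrite x0 normrM normrX normr0 mulrC ler_wpM2r ?exprn_ge0// PM//.
  by rewrite /sqball/= -sqr_enorm x0 expr0n ler01.
have xp : (0 < enorm x)%R by rewrite lt0r x0 enorm_ge0.
have -> : reval P x = (enorm x ^+ k * reval P (radial_proj x))%R.
  by rewrite radial_projE (reval_dilate _ _ Pk) exprVn mulrA mulfV ?mul1r// expf_neq0.
rewrite normrM normrX (ger0_norm (enorm_ge0 x)) mulrC ler_wpM2r ?exprn_ge0 ?enorm_ge0//.
by rewrite PM// /sqball/= -sqr_enorm enorm_radial_proj// expr1n.
Qed.

Section radial_harmonic_integral.
Variables (h : measurableTypeR R -> R) (mh : measurable_fun [set: measurableTypeR R] h).
Hypothesis h0 : forall r, (0 <= h r)%R.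
Variables (C : R) (N : nat).
Hypothesis hC : forall r, (0 <= r)%R -> (h r <= C * (1 + r ^+ N))%R.
Variables (k : nat) (l : 'I_(a k)).
Let F (x : Rvec R d) : R := (h (enorm x) * reval (Y l) x)%R.

(** The integrand is dominated by C M (|x|^k + |x|^(N + k)). The growth condition [hC] covers both
    bounded h (N = 0) and h(r) = r^(2j). *)
Lemma integrable_radial_harmonic (nu : {measure set (Rvec R d) -> \bar R}) :
  (forall N, \int[nu]_x (enorm x ^+ N)%:E < +oo) ->
  nu.-integrable [set: Rvec R d] (EFin \o F).
Proof.
move=> nuoo.
have [hY _] := harmonic_complexify (basis_in Yb l).
have [M M0 YM] := harmonic_growth hY.
have menorm j : measurable_fun [set: Rvec R d] (fun x => (enorm x ^+ j)%:E).
  by apply/measurable_EFinP; apply: measurable_funX; exact: measurable_enorm.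
have inorm j : nu.-integrable [set: Rvec R d] (fun x => (enorm x ^+ j)%:E).
  apply/integrableP; split=> //; apply: le_lt_trans (nuoo j).
  by under eq_integral do rewrite gee0_abs ?lee_fin ?exprn_ge0 ?enorm_ge0//.
have C0 : (0 <= C)%R.
  have := le_trans (h0 0%R) (hC (lexx 0%R)).
  by rewrite pmulr_lge0// ltr_pwDl// exprn_ge0.
apply: (@le_integrable _ _ _ nu _ measurableT _
    (fun x => (C * M)%:E * ((enorm x ^+ k)%:E + (enorm x ^+ (N + k))%:E))).
- apply/measurable_EFinP; apply: measurable_funM; last exact: measurable_reval.
  exact: (measurableT_comp mh (@measurable_enorm R d)).
- move=> x _; rewrite -EFinD -EFinM !abse_EFin lee_fin.
  rewrite [leRHS]ger0_norm; last first.
    by rewrite !mulr_ge0// addr_ge0// exprn_ge0// enorm_ge0.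
  rewrite normrM (ger0_norm (h0 _)).
  apply: (le_trans (ler_pM _ _ (hC (enorm_ge0 x)) (YM x))) => //.
  by rewrite exprD le_eqVlt; apply/orP; left; apply/eqP; ring.
apply: integrableZl => //; exact: integrableD.
Qed.

(** Integrability makes the four integrals in [represents_pairing] finite, so its terms can be moved
    back into a difference. *)
Lemma radial_harmonic_integral nu1 nu2 :
  represents Y s 1 nu1 -> represents Y s (-1) nu2 ->
  (\int[nu1]_x F x - \int[nu2]_x F x =
   \int[sigma l]_(r in [set r : R | 0 <= r]) h r)%R.
Proof.
move=> nu1E nu2E.
have i1 : nu1.-integrable [set: Rvec R d] (EFin \o F).
  by apply: integrable_radial_harmonic => j; apply: (moment_finite _ _ nu1E); rewrite normr1.
have i2 : nu2.-integrable [set: Rvec R d] (EFin \o F).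
  by apply: integrable_radial_harmonic => j; apply: (moment_finite _ _ nu2E); rewrite normrN1.
have := represents_pairing Yb mh h0 l nu1E nu2E.
set J := \int[s l]_r _.
have JE : J = \int[sigma l]_(r in [set r : R | (0 <= r)%R]) (h r)%:E.
  have mJ : measurable_fun [set: measurableTypeR R]
      (fun r => (h `|r : R|%R * `|r : R| ^+ k * `|r : R| ^- k)%:E).
    apply/measurable_EFinP; apply: measurable_funM; last exact: measurable_norm_expV.
    apply: measurable_funM; last by apply: measurable_funX; exact: normr_measurable.
    by apply: (measurableT_comp mh); exact: normr_measurable.
  rewrite /J sE//; last first.
    by move=> r; rewrite lee_fin !mulr_ge0 ?exprn_ge0// invr_ge0 exprn_ge0.
  have mD := measurable_halfline.
  have mh' := measurable_funTS mh.
  (* r^k r^-k = 1 except at r = 0 when k > 0, and then 0 has mass zero. *)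
  have [k0|k0] := posnP k.
    apply: eq_integral => r /set_mem r0; rewrite k0 expr0 invr1 !mulr1.
    by rewrite ger0_norm.
  have m0 : measurable [set 0%R : measurableTypeR R] by exact: measurable_set1.
  have s0 := sigma_set1_eq0 l k0.
  rewrite [LHS](ge0_negligible_integral m0 mD (measurable_funTS mJ) _ s0); last first.
    by move=> r _; rewrite lee_fin !mulr_ge0 ?exprn_ge0// invr_ge0 exprn_ge0.
  rewrite [RHS](ge0_negligible_integral m0 mD _ _ s0); last 2 first.
  - exact/measurable_EFinP.
  - by move=> r _; rewrite lee_fin.
  apply: eq_integral => r /set_mem[/= r0 rn0]; congr EFin.
  rewrite ger0_norm// -mulrA mulfV ?mulr1// expf_neq0//; exact/eqP.
have posE (nu : {measure set (Rvec R d) -> \bar R}) : \int[nu]_x (Num.max (1 * F x) 0)%:E = \int[nu]_x (EFin \o F)^\+ x.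
  by apply: eq_integral => x _; rewrite funeposE mul1r EFin_max.
have negE (nu : {measure set (Rvec R d) -> \bar R}) : \int[nu]_x (Num.max (-1 * F x) 0)%:E = \int[nu]_x (EFin \o F)^\- x.
  by apply: eq_integral => x _; rewrite funenegE mulN1r EFin_max EFinN.
rewrite !posE !negE /Rintegral -JE !(integralE _ _ (EFin \o F)) /=.
have p1 := integrable_pos_fin_num measurableT i1.
have p2 := integrable_pos_fin_num measurableT i2.
have n1 := integrable_neg_fin_num measurableT i1.
have n2 := integrable_neg_fin_num measurableT i2.
have J0 : 0 <= J.
  by apply: integral_ge0 => r _; rewrite lee_fin !mulr_ge0 ?exprn_ge0// invr_ge0 exprn_ge0.
rewrite -(fineK p1) -(fineK p2) -(fineK n1) -(fineK n2).
(* The identity itself excludes J = +oo, its other terms being finite. *)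
case: J J0 {JE} => [j| |]//= _.
rewrite -!EFinD => -[] e /=.
lra.
Qed.

End radial_harmonic_integral.

End moments.

(** * Spanning by the polynomials |x|^(2j) Y_kl *)

Section span.
Context {R : realType} {d : nat} (a : nat -> nat).
Local Notation C := R[i].
Variables (Y : forall k, 'I_(a k) -> mpoly d R) (Yb : harmonic_basis Y).

Lemma complexify_sqnorm : complexify (sqnorm : mpoly d R) = sqnorm.
Proof.
rewrite /complexify /sqnorm raddf_sum; apply: eq_bigr => i _ /=.
by rewrite rmorphXn/= map_mpolyX.
Qed.

(** Split into homogeneous components, decompose each by Gauss, and expand the harmonic pieces in
    the basis. *)
Lemma harmonic_span (d0 : (0 < d)%N) (P : mpoly d C -> Prop) :
  P 0 -> (forall f g, P f -> P g -> P (f + g)) -> (forall c f, P f -> P (c *: f)) ->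
  (forall k (l : 'I_(a k)) j, P (sqnorm ^+ j * complexify (Y l))) ->
  forall f, P f.
Proof.
move=> P0 PD PZ PY f.
rewrite [f](@pihomog_partitionE _ _ (@mdeg d) (mmeasure (@mdeg d) f))//.
elim/big_ind: _ => // k _.
have [h [hH ->]] := gauss_decomposition d0 (pihomogP (@mdeg d) k f).
elim/big_ind: _ => // j _.
have jk : (2 * j <= k)%N by have := ltn_ord j; lia.
have [hom lap0] := hH _ jk.
(* Over [R[i]], [lap] is convertible to [laplacian], so the pair proves [harmonic_homog]. *)
have [c [-> _]] := basis_unique_coord Yb (conj hom lap0).
rewrite mulr_sumr; elim/big_ind: _ => // l _.
by rewrite -scalerAr; exact: PZ.
Qed.

End span.

(** * Linearity of the difference of two integrals *)

Section difference.
Context {R : realType} {dT : measure_display} {T : measurableType dT}.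
Variables n1 n2 : {finite_measure set T -> \bar R}.

Definition both_integrable (u : T -> R) : Prop :=
  n1.-integrable [set: T] (EFin \o u) /\ n2.-integrable [set: T] (EFin \o u).

Definition diff_integral (u : T -> R) : R := \int[n1]_x u x - \int[n2]_x u x.

Lemma both_integrableZD r u v : both_integrable u -> both_integrable v ->
  both_integrable (fun x => r * u x + v x) /\
  diff_integral (fun x => r * u x + v x) = r * diff_integral u + diff_integral v.
Proof.
move=> [u1 u2] [v1 v2].
have iZ (n : {finite_measure set T -> \bar R}) : n.-integrable [set: T] (EFin \o u) ->
    n.-integrable [set: T] (EFin \o (fun x => r * u x)).
  move=> iu; rewrite (_ : _ \o _ = fun x => (r%:E * (EFin \o u) x)%E) //.
  exact: integrableZl.
have iD (n : {finite_measure set T -> \bar R}) : n.-integrable [set: T] (EFin \o u) ->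
    n.-integrable [set: T] (EFin \o v) ->
    n.-integrable [set: T] (EFin \o (fun x => r * u x + v x)).
  move=> iu iv.
  rewrite (_ : _ \o _ = ((EFin \o (fun x => (r * u x)%R)) \+ (EFin \o v))%E) //.
  by apply: integrableD => //; exact: iZ.
split; first by split; exact: iD.
rewrite /diff_integral !RintegralD ?RintegralZl//; try exact: iZ.
by ring.
Qed.

Lemma both_integrable0 : both_integrable (fun=> 0) /\ diff_integral (fun=> 0) = 0.
Proof.
split; first by split; exact: integrable0.
by rewrite /diff_integral /Rintegral !integral0 subrr.
Qed.

End difference.

(** The half-line is closed, so it contains the support [K]; hence h is continuous on the compact
    [K], and it vanishes on the rest of the half-line. *)
Lemma compact_support_bounded (R : realType) (h : R -> R) :
  {within `[0, +oo[, continuous h} ->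
  compact (closure [set r : R | 0 <= r /\ h r != 0]) ->
  exists M : R, forall r, 0 <= r -> h r <= M.
Proof.
move=> ch; set K := closure _ => cK.
have K0 : K `<=` `[0, +oo[.
  have : closed `[0 : R, +oo[%classic by exact: interval_closed.
  move=> /closure_id ->; apply: closureS => r /= [r0 _].
  by rewrite in_itv/= andbT.
have cKh : {within K, continuous h} by exact: continuous_subspaceW K0 ch.
have /compact_bounded[M [_ hM]] := continuous_compact cKh cK.
exists (`|M| + 1) => r r0; have [hr|hr] := eqVneq (h r) 0.
  by rewrite hr addr_ge0.
apply: le_trans (ler_norm _) _; apply: (hM (`|M| + 1)).
  by rewrite (le_lt_trans (ler_norm _))// ltrDl.
by exists r => //; apply: subset_closure.
Qed.

(** * The polynomials on which T is the difference of integrals form a subspace *)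

Section represented.
Context {R : realType} {d : nat}.
Local Notation C := R[i].
Variables (T : {scalar mpoly d R[i]}).
Variables n1 n2 : {finite_measure set (Rvec R d) -> \bar R}.

Definition represented (f : mpoly d C) : Prop :=
  [/\ both_integrable n1 n2 (fun x => complex.Re (ceval f x)),
      both_integrable n1 n2 (fun x => complex.Im (ceval f x))
    & T f = (diff_integral n1 n2 (fun x => complex.Re (ceval f x)) +i*
             diff_integral n1 n2 (fun x => complex.Im (ceval f x)))%C].

Lemma represented0 : represented 0.
Proof.
have [i0 I0] := both_integrable0 n1 n2.
have E : (fun x => complex.Re (ceval (0 : mpoly d C) x)) = fun=> 0.
  by apply/funext => x; rewrite /ceval meval0.
have E' : (fun x => complex.Im (ceval (0 : mpoly d C) x)) = fun=> 0.
  by apply/funext => x; rewrite /ceval meval0.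
by rewrite /represented E E' I0 linear0; split.
Qed.

Lemma representedD f g : represented f -> represented g -> represented (f + g).
Proof.
move=> [fr fi fE] [gr gi gE].
have E x : ceval (f + g) x = ceval f x + ceval g x by rewrite /ceval mevalD.
have Er : (fun x => complex.Re (ceval (f + g) x)) =
    fun x => 1 * complex.Re (ceval f x) + complex.Re (ceval g x).
  by apply/funext => x; rewrite E mul1r; case: (ceval f x) (ceval g x) => ? ? [].
have Ei : (fun x => complex.Im (ceval (f + g) x)) =
    fun x => 1 * complex.Im (ceval f x) + complex.Im (ceval g x).
  by apply/funext => x; rewrite E mul1r; case: (ceval f x) (ceval g x) => ? ? [].
have [ir Ir] := both_integrableZD 1 fr gr.
have [ii Ii] := both_integrableZD 1 fi gi.
by rewrite /represented Er Ei Ir Ii linearD/= fE gE !mul1r; split.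
Qed.

Lemma representedZ c f : represented f -> represented (c *: f).
Proof.
case: c => u v [fr fi fE].
have E x : ceval ((u +i* v)%C *: f) x = (u +i* v)%C * ceval f x.
  by rewrite /ceval mevalZ.
(* [both_integrableZD] handles only r u + v; a final [+ 0] brings the real and imaginary parts of
   the product to that shape. *)
have [i0 I0] := both_integrable0 n1 n2.
have [ir0 Ir0] := both_integrableZD (- v) fi i0.
have [ir Ir] := both_integrableZD u fr ir0.
have [ii0 Ii0] := both_integrableZD v fr i0.
have [ii Ii] := both_integrableZD u fi ii0.
have Er : (fun x => complex.Re (ceval ((u +i* v)%C *: f) x)) =
    fun x => u * complex.Re (ceval f x) + (- v * complex.Im (ceval f x) + 0).
  by apply/funext => x; rewrite E; case: (ceval f x) => ? ? /=; ring.
have Ei : (fun x => complex.Im (ceval ((u +i* v)%C *: f) x)) =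
    fun x => u * complex.Im (ceval f x) + (v * complex.Re (ceval f x) + 0).
  by apply/funext => x; rewrite E; case: (ceval f x) => ? ? /=; ring.
rewrite /represented Er Ei Ir Ir0 Ii Ii0 I0 linearZ/= fE; split=> //.
by simpc; congr (_ +i* _)%C; ring.
Qed.

End represented.

(** * Assembly of the signed measure *)

Theorem theorem7 (R : realType) (d : nat) (d_ge1 : (1 <= d)%N)
    (a : nat -> nat) (Y : forall k, 'I_(a k) -> mpoly d R)
    (Ybasis : harmonic_basis Y)
    (T : {scalar mpoly d R[i]}) (Tpos : pseudo_positive_definite Y T)
    (sigma : forall k, 'I_(a k) -> {measure set (measurableTypeR R) -> \bar R})
    (sigma_support : forall k (l : 'I_(a k)),
      sigma k l [set r : R | r < 0] = 0%E)
    (sigma_integrable : forall k (l : 'I_(a k)) (p : {poly R[i]}),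
      cintegrable (sigma k l) [set r : R | 0 <= r]
        (fun r : R => p.[((r ^+ 2)%:C)%C]))
    (sigma_represents : forall k (l : 'I_(a k)) (p : {poly R[i]}),
      laplace_component Y T l p =
      cintegral (sigma k l) [set r : R | 0 <= r]
        (fun r : R => p.[((r ^+ 2)%:C)%C]))
    (summable : forall N : nat,
      (\sum_(0 <= k <oo) \sum_(l < a k)
         \int[sigma k l]_(r in [set r : R | (0 <= r)%R]) rpow_sub N k r
       < +oo)%E) :
  exists mu : {charge set (Rvec R d) -> \bar R},
    [/\ pseudo_positive mu Y,
        moment_measure mu
      & forall f : mpoly d R[i], T f = signed_cintegral mu (ceval f)].
Proof.
have mD := @measurable_halfline R.
have sigma_fin k (l : 'I_(a k)) :
    (sigma k l [set r : measurableTypeR R | (0 <= r)%R] < +oo)%E.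
  (* The constant polynomial 1 gives the finite mass needed to form [s]. *)
  have [/integrableP[_ +] _] := sigma_integrable k l 1.
  rewrite (eq_integral (cst 1%E)); last by move=> r _; rewrite /= hornerC/= normr1.
  by rewrite integral_cst// mul1e.
pose s k (l : 'I_(a k)) : {finite_measure set (measurableTypeR R) -> \bar R} :=
  mfrestr mD (sigma_fin k l).
have sE k (l : 'I_(a k)) (f : measurableTypeR R -> \bar R) :
    measurable_fun [set: measurableTypeR R] f -> (forall r, 0 <= f r)%E ->
    (\int[s k l]_r f r = \int[sigma k l]_(r in [set r : R | (0 <= r)%R]) f r)%E.
  by move=> mf f0; exact: ge0_integral_mrestr.
have fin_rep e : `|e| <= 1 -> exists n : {finite_measure set (Rvec R d) -> \bar R},
    represents Y s e n.
  move=> e1; have [nu nuE] := pseudo_measure_exists Y s e.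
  have nuoo : (nu setT < +oo)%E.
    (* The moment of order 0 is the total mass, so [nu] is finite and the difference of two such
       measures is a charge. *)
    have := moment_finite Ybasis sE summable 0 e1 nuE.
    by rewrite (eq_integral (cst 1%E))// integral_cst// mul1e.
  have [n nE] := finite_measure_of nuoo; exists n => f mf f0.
  by rewrite -nuE//; apply: eq_measure_integral => A _ _; exact: nE.
have [n1 n1E] : exists n : {finite_measure set (Rvec R d) -> \bar R}, represents Y s 1 n.
  by apply: fin_rep; rewrite normr1.
have [n2 n2E] : exists n : {finite_measure set (Rvec R d) -> \bar R}, represents Y s (-1) n.
  by apply: fin_rep; rewrite normrN1.
have [mu muP] := signed_integral_diff n1 n2.
have integralE (h : measurableTypeR R -> R) (c : R) N k (l : 'I_(a k)) :
    measurable_fun [set: measurableTypeR R] h -> (forall r, 0 <= h r) ->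
    (forall r, 0 <= r -> h r <= c * (1 + r ^+ N)) ->
    both_integrable n1 n2 (fun x => h (enorm x) * reval (Y k l) x) /\
    diff_integral n1 n2 (fun x => h (enorm x) * reval (Y k l) x) =
      \int[sigma k l]_(r in [set r : R | 0 <= r]) h r.
  move=> mh h0 hc; split; last first.
    exact: (radial_harmonic_integral Ybasis sE summable mh h0 hc l n1E n2E).
  split; apply: (integrable_radial_harmonic Ybasis mh h0 hc) => j.
    by apply: (moment_finite Ybasis sE summable _ _ n1E); rewrite normr1.
  by apply: (moment_finite Ybasis sE summable _ _ n2E); rewrite normrN1.
have rep f : represented T n1 n2 f.
  apply: (@harmonic_span _ _ _ _ Ybasis d_ge1 (represented T n1 n2)).
  - exact: represented0.
  - exact: representedD.
  - exact: representedZ.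
  move=> k l j.
  (* Equals p(r^2) for p = X^j, the form in which [sigma_represents] gives T on |x|^(2j) Y_kl. *)
  pose h (r : measurableTypeR R) : R := (r ^+ 2) ^+ j.
  have [|||ih Ih] := integralE h 1 (2 * j)%N k l.
  - by do 2 apply: measurable_funX; exact: measurable_id.
  - by move=> r; rewrite exprn_ge0// sqr_ge0.
  - by move=> r r0; rewrite mul1r /h -exprM lerDr.
  have fE : sqnorm ^+ j * complexify (Y k l) = complexify (sqnorm ^+ j * Y k l).
    by rewrite /complexify rmorphM rmorphXn/= -/(complexify sqnorm) complexify_sqnorm.
  have Er : (fun x => complex.Re (ceval (complexify (sqnorm ^+ j * Y k l)) x)) =
      fun x => h (enorm x) * reval (Y k l) x.
    apply/funext => x; rewrite ceval_complexify/= /reval mevalM rmorphXn/=.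
    by rewrite -!/(reval _ _) -sqr_enorm.
  have Ei : (fun x => complex.Im (ceval (complexify (sqnorm ^+ j * Y k l)) x)) = fun=> 0.
    by apply/funext => x; rewrite ceval_complexify.
  have [i0 I0] := both_integrable0 n1 n2.
  rewrite fE /represented Er Ei I0 Ih; split=> //.
  rewrite -fE; have := sigma_represents k l 'X^j.
  rewrite /laplace_component /radial rmorphXn/= horner_algX => ->.
  rewrite /cintegral; congr (_ +i* _)%C.
    by apply: eq_Rintegral => r _; rewrite hornerXn -[LHS]/(complex.Re ((real_complex R _) ^+ j)) -rmorphXn.
  transitivity (\int[sigma k l]_(r in [set r : R | 0 <= r]) (0 : R)); last first.
    by rewrite /Rintegral integral0.
  by apply: eq_Rintegral => r _; rewrite hornerXn -[LHS]/(complex.Im ((real_complex R _) ^+ j)) -rmorphXn.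
exists mu; split.
- move=> h ch h0 hK k l.
  have [M hM] := compact_support_bounded ch hK.
  (* The even extension is measurable and nonnegative on all of R, while h is controlled on [0, +oo[
     only. *)
  pose H (r : measurableTypeR R) : R := h `|r : R|.
  have HE : (fun x : Rvec R d => h (enorm x) * reval (Y k l) x) =
      fun x => H (enorm x) * reval (Y k l) x.
    by apply/funext => x; rewrite /H ger0_norm// enorm_ge0.
  have [|||[iH1 iH2] IH] := integralE H `|M| 0%N k l.
  - have mh : measurable_fun [set r : measurableTypeR R | (0 <= r)%R] h.
      rewrite (_ : [set r | _] = `[0, +oo[%classic); last first.
        by apply/seteqP; split=> r /=; rewrite in_itv/= andbT.
      exact: subspace_continuous_measurable_fun.
    apply: (measurable_comp mD _ mh); last exact: normr_measurable.
    by move=> _ [r _ <-] /=.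
  - by move=> r; rewrite h0.
  - move=> r r0; rewrite /H ger0_norm// expr0; apply: le_trans (hM _ r0) _.
    by apply: le_trans (ler_norm _) _; rewrite ler_peMr// lerDl.
  rewrite HE (muP _ iH1 iH2).2 -/(diff_integral _ _ _) IH.
  by apply: Rintegral_ge0 => r r0; exact: h0.
- move=> f; have [[r1 r2] [i1 i2] _] := rep f.
  by split; [exact: (muP _ r1 r2).1|exact: (muP _ i1 i2).1].
move=> f; have [[r1 r2] [i1 i2] ->] := rep f.
by rewrite /signed_cintegral (muP _ r1 r2).2 (muP _ i1 i2).2.
Qed.
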